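(* Let $f:\mathbb{R}^n\to\mathbb{R}$, $g:\mathbb{R}^n\to\mathbb{R}^m$, $h:\mathbb{R}^n\to\mathbb{R}^p$ be continuously differentiable, let $s<n$, let $S=\{x\in\mathbb{R}^n : \|x\|_0\le s\}$, and consider the problem (CCOP) $$\min_x f(x)\quad\text{s.t.}\quad g(x)\le0,\ h(x)=0,\ \|x\|_0\le s,$$ with feasible region $\mathcal{F}_{\rm CCOP}$. Let $x^*\in\mathcal{F}_{\rm CCOP}$. If one of the constraint qualifications CCOP-LICQ, CCOP-NNAMCQ, CCOP-CRCQ, CCOP-RCRCQ, CCOP-CPLD, CCOP-ERCPLD, CCOP-RCPLD holds at $x^*$, then there exist $\alpha\ge0$ and $\rho>0$ such that $$d_{\mathcal{F}_{\rm CCOP}}(x)\le\alpha\Bigl(\sum_{i=1}^m\max\{g_i(x),0\}+\sum_{i=1}^p|h_i(x)|\Bigr)\qquad\forall x\in\mathbb{B}_\rho(x^* )\cap S.$$ Moreover, if $x^*$ is a local optimal solution of CCOP, then it is also a local optimal solution of the exact penalty problem $$\min_x\ f(x)+\mu\Bigl(\sum_{i=1}^m\max\{g_i(x),0\}+\sum_{i=1}^p|h_i(x)|\Bigr)\quad\text{s.t.}\quad\|x\|_0\le s$$ for any $\mu\ge L_f\alpha$, where $L_f$ is the Lipschitz constant of $f$ at $x^*$ (i.e. a Lipschitz constant of $f$ on a neighborhood of $x^*$).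
   Context: Notation. $\|x\|_0$ is the number of nonzero components of $x$; $I_\pm(x)=\{i : x_i\ne0\}$, $I_0(x)=\{i : x_i=0\}$; $e_i$ are the standard basis vectors; $\mathcal{I}_g(x^* )=\{i : g_i(x^* )=0\}$; $\mathbb{B}_\rho(x^* )$ is the open ball; $d_\Omega$ the distance function (in the same norm used for $L_f$). A pair of families $(\{v_i\}_{i\in I},\{u_i\}_{i\in J})$ is positive linearly dependent if there are scalars $\alpha_i\ge0$ ($i\in I$), $\beta_i$ ($i\in J$), not all zero, with $\sum_{i\in I}\alpha_iv_i+\sum_{i\in J}\beta_iu_i=0$. Two conditions used below, for $\eta\in\mathbb{R}^n$ and an index set $K$: (E) $\eta_i=0$ for all $i\in I_\pm(x^* )$ and $\|\eta\|_0\le n-s$. (K) if $\eta\ne0$, then $I_\pm(\eta)\subseteq K\subseteq I_0(x^* )$ and $|K|\le n-s$; if $\eta=0$, then $K=\emptyset$. Constraint qualifications at a feasible $x^*$: CCOP-LICQ: the family $\{\nabla g_i(x^* )\}_{i\in\mathcal{I}_g(x^* )}\cup\{\nabla h_i(x^* )\}_{i=1}^p\cup\{e_i\}_{i\in I_0(x^* )}$ is linearly independent. CCOP-NNAMCQ: there is no nonzero $(\lambda^g,\lambda^h,\eta)\in\mathbb{R}^m\times\mathbb{R}^p\times\mathbb{R}^n$ with $\lambda^g_i\ge0$ for $i\in\mathcal{I}_g(x^* )$, $\lambda_i^g=0$ for $i\notin\mathcal{I}_g(x^* )$, $\eta$ satisfying (E), and $\sum_{i\in\mathcal{I}_g(x^*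 )}\lambda_i^g\nabla g_i(x^* )+\sum_{i=1}^p\lambda_i^h\nabla h_i(x^* )+\eta=0$. CCOP-RCPLD: (i) there is $\varepsilon>0$ such that $\{\nabla h_i(x)\}_{i=1}^p$ has the same rank for all $x\in\mathbb{B}_\varepsilon(x^* )$; (ii) let $J\subseteq\{1,\dots,p\}$ be such that $\{\nabla h_i(x^* )\}_{i\in J}$ is a basis of $\operatorname{span}\{\nabla h_i(x^* )\}_{i=1}^p$. Whenever there are $I\subseteq\mathcal{I}_g(x^* )$ and $(\lambda^g_i)_{i\in I}$, $(\lambda_i^h)_{i\in J}$, $\eta$, not all zero, with $\lambda_i^g\ge0$ for $i\in I$, $\eta$ satisfying (E), and $\sum_{i\in I}\lambda_i^g\nabla g_i(x^* )+\sum_{i\in J}\lambda_i^h\nabla h_i(x^* )+\eta=0$, then for every sequence $x^k\to x^*$, $x^k\ne x^*$, and every $K$ satisfying (K), the family $\{\nabla g_i(x^k)\}_{i\in I}\cup\{\nabla h_i(x^k)\}_{i\in J}\cup\{e_i\}_{i\in K}$ is linearly dependent for all sufficiently large $k$. CCOP-CPLD: condition (ii) of CCOP-RCPLD holds with $J$ taken to be an arbitrary subset of $\{1,\dots,p\}$. CCOP-CRCQ: for all index sets $I\subseteq\mathcal{I}_g(x^* )$, $J\subseteq\{1,\dots,p\}$, every $\eta$ satisfying (E), every $K$ satisfying (K) and every sequence $x^k\to x^*$, $x^k\ne x^*$, the families $\{\nabla g_i(x^* )\}_{i\in I}\cup\{\nabla h_i(x^* )\}_{i\in J}\cup\{e_i\}_{i\in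 K}$ and $\{\nabla g_i(x^k)\}_{i\in I}\cup\{\nabla h_i(x^k)\}_{i\in J}\cup\{e_i\}_{i\in K}$ have the same rank for all sufficiently large $k$. CCOP-RCRCQ: as CCOP-CRCQ, but only with $J=\{1,\dots,p\}$. CCOP-ERCPLD: (i) as in CCOP-RCPLD; (ii) let $J$ be as in CCOP-RCPLD (ii). Whenever $I\subseteq\mathcal{I}_g(x^* )$, $\eta$ satisfies (E), $K$ satisfies (K), and the pair $(\{\nabla g_i(x^* )\}_{i\in I},\{\nabla h_i(x^* )\}_{i\in J}\cup\{e_i\}_{i\in K})$ is positive linearly dependent, then for every sequence $x^k\to x^*$, $x^k\ne x^*$, the family $\{\nabla g_i(x^k)\}_{i\in I}\cup\{\nabla h_i(x^k)\}_{i\in J}\cup\{e_i\}_{i\in K}$ is linearly dependent for all sufficiently large $k$. *)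

(* Defs.v *)
From HB Require Import structures.
From mathcomp Require Import all_boot all_order all_algebra.
From mathcomp Require Import all_classical all_reals all_analysis.

Set Implicit Arguments.
Unset Strict Implicit.
Unset Printing Implicit Defensive.

Import Order.TTheory GRing.Theory Num.Theory.
Import numFieldNormedType.Exports.

Local Open Scope classical_set_scope.
Local Open Scope ring_scope.

(* The library's norm on ['rV_n] is the sup norm, so the Euclidean norm, its
   balls and its distance function are defined here.  Limits, continuity and
   differentiability do not depend on the norm and use the library notions. *)
Definition enorm (R : realType) (n : nat) (x : 'rV[R]_n) : R :=
  Num.sqrt (\sum_(i < n) x ord0 i ^+ 2).

Definition eball (R : realType) (n : nat) (c : 'rV[R]_n) (r : R) :
    set 'rV[R]_n :=
  [set x | enorm (x - c) < r].

Definition set_dist (R : realType) (n : nat) (Omega : set 'rV[R]_n)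
    (x : 'rV[R]_n) : R :=
  inf [set enorm (x - y) | y in Omega].

Definition lipschitz_near (R : realType) (n : nat) (f : 'rV[R]_n -> R)
    (c : 'rV[R]_n) (L : R) : Prop :=
  exists2 r : R, 0 < r &
    forall x y, eball c r x -> eball c r y -> `|f x - f y| <= L * enorm (x - y).

Definition local_optimal (R : realType) (n : nat) (F : 'rV[R]_n -> R)
    (Omega : set 'rV[R]_n) (c : 'rV[R]_n) : Prop :=
  Omega c /\
  exists2 r : R, 0 < r & forall x, Omega x -> eball c r x -> F c <= F x.

(* On a finite-dimensional domain, continuity of [x |-> 'd F x v] for each [v]
   is continuity of the derivative in operator norm. *)
Definition C1 (R : realType) (n : nat) (W : normedModType R)
    (F : 'rV[R]_n -> W) : Prop :=
  (forall x, differentiable F x) /\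
  (forall v : 'rV[R]_n, continuous (fun x => 'd F x v)).

(* ['J G x] acts on row vectors from the right, so the gradient of the i-th
   component of [G] is its i-th column. *)
Definition grad (R : realType) (n q : nat) (G : 'rV[R]_n -> 'rV[R]_q)
    (x : 'rV[R]_n) (i : 'I_q) : 'rV[R]_n :=
  row i ('J G x)^T.

Definition Ipm (R : realType) (n : nat) (x : 'rV[R]_n) : {set 'I_n} :=
  [set i | x ord0 i != 0]%SET.

Definition I0 (R : realType) (n : nat) (x : 'rV[R]_n) : {set 'I_n} :=
  [set i | x ord0 i == 0]%SET.

Definition norm0 (R : realType) (n : nat) (x : 'rV[R]_n) : nat := #|Ipm x|.

Definition sparse (R : realType) (n s : nat) : set 'rV[R]_n :=
  [set x | (norm0 x <= s)%N].

Definition feasible (R : realType) (n m p s : nat)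
    (g : 'rV[R]_n -> 'rV[R]_m) (h : 'rV[R]_n -> 'rV[R]_p) : set 'rV[R]_n :=
  [set x | [/\ forall i, g x ord0 i <= 0,
               forall i, h x ord0 i = 0
             & sparse s x]].

Definition violation (R : realType) (n m p : nat)
    (g : 'rV[R]_n -> 'rV[R]_m) (h : 'rV[R]_n -> 'rV[R]_p)
    (x : 'rV[R]_n) : R :=
  \sum_(i < m) Num.max (g x ord0 i) 0 + \sum_(i < p) `|h x ord0 i|.

Definition active (R : realType) (n m : nat) (g : 'rV[R]_n -> 'rV[R]_m)
    (x : 'rV[R]_n) : {set 'I_m} :=
  [set i | g x ord0 i == 0]%SET.

(* Families of vectors are sequences, so repeated vectors count: [free]
   is linear independence of the family, and [\dim <<_>>] is its rank. *)
Definition unit_family (R : realType) (n : nat) (K : {set 'I_n}) :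
    seq 'rV[R]_n :=
  [seq delta_mx ord0 i | i in K].

Definition grad_family (R : realType) (n q : nat) (G : 'rV[R]_n -> 'rV[R]_q)
    (J : {set 'I_q}) (x : 'rV[R]_n) : seq 'rV[R]_n :=
  [seq grad G x i | i in J].

Definition family_at (R : realType) (n m p : nat)
    (g : 'rV[R]_n -> 'rV[R]_m) (h : 'rV[R]_n -> 'rV[R]_p)
    (I : {set 'I_m}) (J : {set 'I_p}) (K : {set 'I_n}) (x : 'rV[R]_n) :
    seq 'rV[R]_n :=
  grad_family g I x ++ grad_family h J x ++ unit_family R K.

Definition pos_lin_dep (R : realType) (n : nat) (vs us : seq 'rV[R]_n) : Prop :=
  exists (a : 'I_(size vs) -> R) (b : 'I_(size us) -> R),
    [/\ forall i, 0 <= a i,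
        (exists i, a i != 0) \/ (exists j, b j != 0)
      & \sum_i a i *: vs`_i + \sum_j b j *: us`_j = 0].

Definition condE (R : realType) (n s : nat) (xs eta : 'rV[R]_n) : Prop :=
  (forall i, i \in Ipm xs -> eta ord0 i = 0) /\ (norm0 eta <= n - s)%N.

Definition condK (R : realType) (n s : nat) (xs eta : 'rV[R]_n)
    (K : {set 'I_n}) : Prop :=
  (eta != 0 -> [/\ Ipm eta \subset K, K \subset I0 xs & (#|K| <= n - s)%N]) /\
  (eta = 0 -> K = finset.set0).

Definition approaching (R : realType) (n : nat) (xs : 'rV[R]_n)
    (u : nat -> 'rV[R]_n) : Prop :=
  u @ \oo --> xs /\ forall k, u k != xs.

Definition ccop_licq (R : realType) (n m p : nat)
    (g : 'rV[R]_n -> 'rV[R]_m) (h : 'rV[R]_n -> 'rV[R]_p)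
    (xs : 'rV[R]_n) : Prop :=
  free (family_at g h (active g xs) [set: 'I_p]%SET (I0 xs) xs).

Definition ccop_nnamcq (R : realType) (n m p s : nat)
    (g : 'rV[R]_n -> 'rV[R]_m) (h : 'rV[R]_n -> 'rV[R]_p)
    (xs : 'rV[R]_n) : Prop :=
  ~ exists (lg : 'rV[R]_m) (lh : 'rV[R]_p) (eta : 'rV[R]_n),
      (lg, lh, eta) <> (0, 0, 0) /\
      [/\ forall i, i \in active g xs -> 0 <= lg ord0 i,
          forall i, i \notin active g xs -> lg ord0 i = 0,
          condE s xs eta
        & \sum_(i in active g xs) lg ord0 i *: grad g xs i
          + \sum_(i < p) lh ord0 i *: grad h xs i + eta = 0].

Definition const_rank_eq (R : realType) (n p : nat)
    (h : 'rV[R]_n -> 'rV[R]_p) (xs : 'rV[R]_n) : Prop :=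
  exists2 eps : R, 0 < eps &
    forall x, eball xs eps x ->
      \dim <<grad_family h [set: 'I_p]%SET x>>
      = \dim <<grad_family h [set: 'I_p]%SET xs>>.

Definition eq_basis (R : realType) (n p : nat)
    (h : 'rV[R]_n -> 'rV[R]_p) (xs : 'rV[R]_n) (J : {set 'I_p}) : Prop :=
  basis_of <<grad_family h [set: 'I_p]%SET xs>> (grad_family h J xs).

Definition cpld_at (R : realType) (n m p s : nat)
    (g : 'rV[R]_n -> 'rV[R]_m) (h : 'rV[R]_n -> 'rV[R]_p)
    (xs : 'rV[R]_n) (J : {set 'I_p}) : Prop :=
  forall (I : {set 'I_m}) (lg : 'I_m -> R) (lh : 'I_p -> R) (eta : 'rV[R]_n),
    I \subset active g xs ->
    [\/ exists2 i, i \in I & lg i != 0,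
        exists2 j, j \in J & lh j != 0
      | eta != 0] ->
    (forall i, i \in I -> 0 <= lg i) ->
    condE s xs eta ->
    \sum_(i in I) lg i *: grad g xs i + \sum_(j in J) lh j *: grad h xs j
      + eta = 0 ->
    forall (u : nat -> 'rV[R]_n) (K : {set 'I_n}),
      approaching xs u -> condK s xs eta K ->
      \forall k \near \oo, ~~ free (family_at g h I J K (u k)).

Definition ccop_rcpld (R : realType) (n m p s : nat)
    (g : 'rV[R]_n -> 'rV[R]_m) (h : 'rV[R]_n -> 'rV[R]_p)
    (xs : 'rV[R]_n) : Prop :=
  const_rank_eq h xs /\
  (forall J : {set 'I_p}, eq_basis h xs J -> cpld_at s g h xs J).

Definition ccop_cpld (R : realType) (n m p s : nat)
    (g : 'rV[R]_n -> 'rV[R]_m) (h : 'rV[R]_n -> 'rV[R]_p)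
    (xs : 'rV[R]_n) : Prop :=
  forall J : {set 'I_p}, cpld_at s g h xs J.

Definition crcq_at (R : realType) (n m p s : nat)
    (g : 'rV[R]_n -> 'rV[R]_m) (h : 'rV[R]_n -> 'rV[R]_p)
    (xs : 'rV[R]_n) (J : {set 'I_p}) : Prop :=
  forall (I : {set 'I_m}) (eta : 'rV[R]_n) (K : {set 'I_n})
      (u : nat -> 'rV[R]_n),
    I \subset active g xs -> condE s xs eta -> condK s xs eta K ->
    approaching xs u ->
    \forall k \near \oo,
      \dim <<family_at g h I J K xs>> = \dim <<family_at g h I J K (u k)>>.

Definition ccop_crcq (R : realType) (n m p s : nat)
    (g : 'rV[R]_n -> 'rV[R]_m) (h : 'rV[R]_n -> 'rV[R]_p)
    (xs : 'rV[R]_n) : Prop :=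
  forall J : {set 'I_p}, crcq_at s g h xs J.

Definition ccop_rcrcq (R : realType) (n m p s : nat)
    (g : 'rV[R]_n -> 'rV[R]_m) (h : 'rV[R]_n -> 'rV[R]_p)
    (xs : 'rV[R]_n) : Prop :=
  crcq_at s g h xs [set: 'I_p]%SET.

Definition ccop_ercpld (R : realType) (n m p s : nat)
    (g : 'rV[R]_n -> 'rV[R]_m) (h : 'rV[R]_n -> 'rV[R]_p)
    (xs : 'rV[R]_n) : Prop :=
  const_rank_eq h xs /\
  (forall J : {set 'I_p}, eq_basis h xs J ->
   forall (I : {set 'I_m}) (eta : 'rV[R]_n) (K : {set 'I_n}),
     I \subset active g xs -> condE s xs eta -> condK s xs eta K ->
     pos_lin_dep (grad_family g I xs)
                 (grad_family h J xs ++ unit_family R K) ->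
     forall u : nat -> 'rV[R]_n, approaching xs u ->
       \forall k \near \oo, ~~ free (family_at g h I J K (u k))).

(* Main.v *)
Require Import Defs.
From HB Require Import structures.
From mathcomp Require Import all_boot all_order all_algebra.
From mathcomp Require Import all_classical all_reals all_analysis.
From mathcomp Require Import ring lra.

Set Implicit Arguments.
Unset Strict Implicit.
Unset Printing Implicit Defensive.

Import Order.TTheory GRing.Theory Num.Theory.
Import numFieldNormedType.Exports.

Local Open Scope classical_set_scope.
Local Open Scope ring_scope.

(** Why the theorem holds.

    The sparse set is a finite union of coordinate subspaces.  A sparse point
    [y] close to [xs] vanishes on a set [T] of exactly [n - s] coordinates, and
    since coordinates that are nonzero at [xs] stay nonzero nearby, [xs]
    vanishes on [T] too.  On the subspace of the points vanishing on [T] the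
    cardinality constraint disappears, and what has to be proved is an error
    bound for the system [g <= 0], [h = 0] there, with a constant independent
    of [T].

    Each of the seven qualifications reduces to the CPLD implication, taken
    either for all index sets [J] of equality constraints or for the bases of
    the equality gradients at [xs] together with the local constancy of their
    rank.  In both cases the equality gradients at every nearby point [x] have
    a basis indexed by some [J] for which the implication holds
    ([cq_cpld_basis]).

    For such a [J] the implication says exactly that multipliers cannot blow
    up: as long as the gradients and unit vectors in use are linearly
    independent at [x], the sum of the absolute values of the multipliers is at
    most [M] times the norm of the combination, with one [M] for all [x] near
    [xs] ([uniform_bounded_multipliers]).  Otherwise normalised multipliers
    along a sequence tending to [xs] would have a nonzero limit combining to
    zero at [xs], and CPLD would make the family dependent along the sequence.

    Now let [x] minimise the squared distance to [y] plus [k] times the sum of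
    the squared violations over the subspace given by [T] ([penalty_minimizer]).
    Stationarity writes [y - x] as a combination of gradients of violated
    constraints and unit vectors.  Rewriting the equality part in a basis and
    applying a Caratheodory reduction that keeps signs, the combination becomes
    linearly independent, so its multipliers are at most [M * enorm (y - x)].
    Taking the inner product with [y - x] and expanding [g] and [h] to first
    order, with relative error [1 / (2 M)], gives
    [enorm (y - x) <= 2 M (violation y + sum |h (x)|)]
    ([stationary_estimate]).  As [k] tends to infinity the minimisers accumulate
    at a feasible point within [2 M violation y] of [y]
    ([local_error_bound]).

    Exactness of the penalty follows by comparing [f] at [x] with [f] at the
    feasible point that the error bound provides ([exact_penalty]). *)

(** * Linear independence of indexed families *)

(** Indexing by a set, rather than by a sequence as [free] does, makes a
    subfamily a subset and a coefficient a function of the index. *)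
Definition indep (F : fieldType) (V : lmodType F) (T : finType) (v : T -> V)
    (A : {set T}) : Prop :=
  forall c : T -> F, \sum_(i in A) c i *: v i = 0 ->
    forall i, i \in A -> c i = 0.

Lemma indepS (F : fieldType) (V : lmodType F) (T : finType) (v : T -> V)
    (A B : {set T}) : A \subset B -> indep v B -> indep v A.
Proof.
move=> sAB hB c hc i iA.
have := hB (fun t => if t \in A then c t else 0) _ i (fintype.subsetP sAB i iA).
rewrite iA; apply; rewrite -[RHS]hc big_mkcond [RHS]big_mkcond; apply: eq_bigr => t _.
have [tA|tA] := boolP (t \in A); first by rewrite (fintype.subsetP sAB).
by rewrite scale0r if_same.
Qed.

(** Shift [c] along a dependency, by the coefficient ratio of least absolute
    value among the indices outside [B]: one such coefficient vanishes and none
    of the others changes sign.  Independence of [B] guarantees that every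
    dependency involves an index outside [B]. *)
Lemma sign_preserving_caratheodory (F : realFieldType) (V : lmodType F) (T : finType)
    (v : T -> V) (B : {set T}) (c : T -> F) :
  indep v B ->
  exists c' : T -> F,
    [/\ \sum_i c' i *: v i = \sum_i c i *: v i,
        indep v (B :|: [set i | c' i != 0])%SET &
        forall i, i \notin B -> (0 <= c i -> 0 <= c' i) /\
                                (c i = 0 -> c' i = 0)].
Proof.
move=> hB; have [N] := ubnP #|([set i | c i != 0] :\: B)%SET|.
elim: N c => // N IH c hN.
set A := (B :|: [set i | c i != 0])%SET.
have [hA|] := pselect (indep v A).
  by exists c; split.
move=> /existsNP[d] /not_implyP[hd] /existsNP[i0] /not_implyP[i0A di0].
pose P i := (i \in A) && (i \notin B) && (d i != 0).
have [i1 Pi1] : exists i, P i.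
  apply: contrapT => /forallNP hP; apply: di0.
  have dB i : i \in A -> i \notin B -> d i = 0.
    by move=> iA iB; apply/eqP/negP => di; apply: (hP i); rewrite /P iA iB; apply/negP.
  have [i0B|i0B] := boolP (i0 \in B); last exact: dB.
  apply: (hB d) i0B; apply: etrans hd; apply/esym.
  rewrite (big_setID B) /= [X in _ + X]big1 ?addr0.
    by apply: eq_bigl => i; rewrite !inE; case: (i \in B); rewrite ?andbT ?andbF.
  by move=> i /setDP[iA iB]; rewrite dB// scale0r.
case: (Order.TotalTheory.arg_minP (fun i => `|c i / d i|) Pi1) => i2 Pi2 hmin.
have [/andP[i2A i2B] di2] := andP Pi2.
pose t := c i2 / d i2.
pose c' i := c i - (if i \in A then t * d i else 0).
have ci2 : c i2 != 0 by move: i2A; rewrite !inE (negbTE i2B).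
have sgn i : i \notin B -> (0 <= c i -> 0 <= c' i) /\ (c i = 0 -> c' i = 0).
  move=> iB; rewrite /c'; case: ifPn => [iA|]; last by rewrite subr0.
  split=> [ci|ci]; last by move: iA; rewrite !inE (negbTE iB) ci eqxx.
  have [->|di] := eqVneq (d i) 0; first by rewrite mulr0 subr0.
  have := hmin i; rewrite /P iA iB di => /(_ isT).
  rewrite -/t [leRHS]normrM normfV ler_pdivlMr ?normr_gt0// -normrM (ger0_norm ci).
  by rewrite subr_ge0; apply: le_trans; exact: ler_norm.
have [|c'' [e1 e2 e3]] := IH c'.
  rewrite -ltnS; apply: leq_trans hN; rewrite ltnS; apply: proper_card.
  apply/properP; split.
    apply/fintype.subsetP => i; rewrite !inE => /andP[iB ci']; rewrite iB /=.
    by apply: contra ci' => /eqP ci; apply/eqP/(sgn i iB).2.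
  exists i2; rewrite !inE i2B //= /c' i2A /t divfK// subrr eqxx //.
exists c''; split => //.
  rewrite e1 /c'; under eq_bigr do rewrite scalerBl.
  rewrite sumrB; apply/eqP; rewrite subr_eq addrC -subr_eq subrr; apply/eqP/esym.
  transitivity (t *: \sum_(i in A) d i *: v i); last by rewrite hd scaler0.
  rewrite scaler_sumr [RHS]big_mkcond; apply: eq_bigr => i _.
  by case: ifP => _; rewrite ?scale0r ?scalerA.
move=> i iB; have [a b] := sgn i iB; have [a' b'] := e3 i iB.
by split=> ci; [apply/a'/a|apply/b'/b].
Qed.

Lemma mem_span_map (F : fieldType) (V : vectType F) (T : finType)
    (v : T -> V) (s : seq T) (x : V) :
  uniq s -> reflect (exists c : T -> F, x = \sum_(i <- s) c i *: v i)
                    (x \in <<map v s>>%VS).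
Proof.
move=> us; apply: (iffP idP); last first.
  move=> [c ->]; rewrite big_seq; apply: memv_suml => i si.
  by apply: memvZ; apply: memv_span; exact: map_f.
elim: s us x => [_ x|a s IH /= /andP[as_ us] x].
  by rewrite /= span_nil memv0 => /eqP ->; exists (fun=> 0); rewrite big_nil.
rewrite span_cons => /memv_addP[_ /vlineP[k ->] [w /(IH us)[c ->] ->]].
exists (fun i => if i == a then k else c i); rewrite big_cons eqxx.
congr (_ + _); apply: eq_big_seq => i si; case: eqP => // ia.
by rewrite -ia si in as_.
Qed.

Lemma free_map_indep (F : fieldType) (V : vectType F) (T : finType)
    (v : T -> V) (s : seq T) :
  uniq s -> free (map v s) <-> indep v [set i in s]%SET.
Proof.
have sums (s' : seq T) (us : uniq s') (c : T -> F) :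
    \sum_(i in [set i in s']%SET) c i *: v i = \sum_(i <- s') c i *: v i.
  by rewrite big_uniq//; apply: eq_bigl => i; rewrite inE.
elim: s => [|a s IH] /=.
  by move=> _; rewrite nil_free; split=> // _ c _ i; rewrite !inE.
case/andP=> as_ us; rewrite free_cons.
have uas : uniq (a :: s) by rewrite /= as_.
split=> [/andP[av /(IH us) hs] c|h].
  rewrite sums// big_cons => /eqP; rewrite addr_eq0 => /eqP ca.
  have ca0 : c a = 0.
    apply/eqP/negPn/negP => ca0; move/negP: av; apply.
    apply/mem_span_map => //; exists (fun i => - ((c a)^-1 * c i)).
    rewrite -[v a](scalerK ca0) ca scalerN scaler_sumr -sumrN.
    by apply: eq_bigr => i _; rewrite scaleNr scalerA.
  move=> i; rewrite !inE => /orP[/eqP ->//|si]; apply: (hs c); last by rewrite inE.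
  by rewrite sums//; apply/eqP; rewrite -oppr_eq0 -ca ca0 scale0r.
apply/andP; split.
  apply/negP => /mem_span_map-/(_ us)[c e].
  have h1 := h (fun i => if i == a then -1 else c i) ^~ a.
  move: h1; rewrite !inE eqxx sums// big_cons eqxx scaleN1r => h1.
  have : -1 = 0 :> F.
    apply: h1 => //; apply/eqP; rewrite addrC subr_eq0; apply/eqP; rewrite [RHS]e.
    by apply: eq_big_seq => i si; case: eqP => // ia; rewrite -ia si in as_.
  by move/eqP; rewrite oppr_eq0 oner_eq0.
apply/(IH us) => c; rewrite sums// => e i si.
have := h (fun i => if i == a then 0 else c i) ^~ i.
have ia : i != a by apply: contraNneq as_ => <-; rewrite inE in si.
rewrite sums// big_cons eqxx scale0r add0r (negbTE ia); apply.
  rewrite -[RHS]e; apply: eq_big_seq => j sj; case: eqP => // ja.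
  by rewrite -ja sj in as_.
by move: si; rewrite !inE => ->; rewrite orbT.
Qed.

Lemma free_image_indep (F : fieldType) (V : vectType F) (T : finType)
    (v : T -> V) (A : {set T}) :
  free [seq v i | i in A] <-> indep v A.
Proof.
by rewrite /image_mem free_map_indep ?enum_uniq// set_enum.
Qed.

Lemma exists_image_basis (F : fieldType) (V : vectType F) (T : finType)
    (v : T -> V) :
  exists J : {set T}, free [seq v i | i in J] /\
    <<[seq v i | i in J]>>%VS = <<[seq v i | i in [set: T]%SET]>>%VS.
Proof.
pose P (A : {set T}) := free [seq v i | i in A].
have P0 : P finset.set0.
  by rewrite /P /image_mem enum_set0 nil_free.
case: (arg_maxnP (fun A : {set T} => #|A|) P0) => J hJ hmax.
exists J; split=> //; apply/eqP; rewrite eqEsubv; apply/andP; split.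
  apply: sub_span => x /mapP[i iJ ->]; apply: map_f.
  by rewrite mem_enum inE.
apply/span_subvP => _ /mapP[i _ ->].
have [iJ|iJ] := boolP (i \in J); first by apply/memv_span/map_f; rewrite mem_enum.
apply/negPn/negP => hi.
have : P (i |: J)%SET.
  rewrite /P (perm_free (Y := v i :: [seq v k | k in J])); first by rewrite free_cons hi.
  rewrite /image_mem -(map_cons v i); apply: perm_map; apply: uniq_perm.
  - exact: enum_uniq.
  - by rewrite /= mem_enum iJ enum_uniq.
  - by move=> k; rewrite mem_enum !inE mem_enum.
by move/hmax; rewrite /= cardsU1 iJ add1n ltnn.
Qed.

(** * Compactness: limits of normalised multipliers *)

Lemma increasing_seq_cvg (phi : nat -> nat) :
  increasing_seq phi -> phi @ \oo --> \oo.
Proof.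
move=> hphi A [N _ hN]; exists N => // k /= Nk; apply: hN => /=.
apply: (leq_trans Nk); elim: k {Nk} => // k IH.
by apply: (leq_ltn_trans IH); rewrite ltnNge -leEnat hphi ltnn.
Qed.

Lemma bolzano_weierstrass_fin (R : realType) (T : finType)
    (c : nat -> T -> R) (M : R) :
  (forall k t, `|c k t| <= M) ->
  exists2 phi : nat -> nat, increasing_seq phi &
    exists l : T -> R, forall t, c (phi k) t @[k --> \oo] --> l t.
Proof.
move=> hM.
suff [phi hphi [l hl]] : exists2 phi : nat -> nat, increasing_seq phi &
    exists l : T -> R, forall t, t \in enum T -> c (phi k) t @[k --> \oo] --> l t.
  by exists phi => //; exists l => t; apply: hl; rewrite mem_enum.
elim: (enum T) => [|a s [phi hphi [l hl]]].
  by exists id => //; exists (fun=> 0).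
have [|psi hpsi /cvg_ex[la hla]] := @bolzano_weierstrass R (fun k => c (phi k) a).
  by exists M; split; [exact: num_real|move=> N MN k _ /=; exact/ltW/(le_lt_trans _ MN)].
exists (phi \o psi); first by move=> i j; rewrite /= hphi -leEnat hpsi.
exists (fun t => if t == a then la else l t) => t; rewrite inE.
have [->|_ /= ts] := eqVneq t a; first by move=> _; exact: hla.
by apply: (cvg_comp psi (fun k => c (phi k) t)); [exact: increasing_seq_cvg|exact: hl].
Qed.

Lemma not_near_seq (R : realType) (V : normedModType R) (x0 : V)
    (P : nat -> V -> Prop) :
  (forall k, ~ \forall x \near x0, P k x) ->
  exists2 u : nat -> V, u @ \oo --> x0 & forall k, ~ P k (u k).
Proof.
move=> hP.
have /choice[u hu] : forall k, exists x, ball x0 k.+1%:R^-1 x /\ ~ P k x.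
  move=> k; apply: contrapT => /forallNP h; apply: (hP k).
  apply/nbhs_ballP; exists k.+1%:R^-1 => /=; first by rewrite invr_gt0 ltr0n.
  by move=> x xb; apply: contrapT => nP; apply: (h x).
exists u; last by move=> k; case: (hu k).
apply/cvgrPdist_lt => e e0; near=> k.
have [+ _] := hu k; rewrite -ball_normE /= => /lt_trans; apply.
by near: k; exact: near_infty_natSinv_lt (PosNum e0).
Unshelve. all: by end_near. Qed.

Lemma cvg_rowP (R : realType) (n : nat) (U : Type) (F : set_system U)
    (FF : Filter F) (u : U -> 'rV[R]_n) (l : 'rV[R]_n) :
  u x @[x --> F] --> l <-> forall j, u x ord0 j @[x --> F] --> l ord0 j.
Proof.
split=> [h j|h].
  exact: (continuous_cvg _ (@coord_continuous R 1 n ord0 j l) h).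
apply/cvgrPdist_lt => e e0; near=> k.
rewrite [`|_|]mx_normrE; apply/bigmax_ltP; split=> // -[i j] _ /=.
rewrite !mxE (ord1 i); move: j; near: k; apply: filter_forall => j.
by have /cvgrPdist_lt := h j; exact.
Unshelve. all: by end_near. Qed.

Lemma cvg_sum (R : realType) (V : normedModType R) (U I : Type)
    (F : set_system U) (FF : Filter F) (r : seq I) (P : pred I)
    (f : I -> U -> V) (l : I -> V) :
  (forall i, P i -> f i x @[x --> F] --> l i) ->
  \sum_(i <- r | P i) f i x @[x --> F] --> \sum_(i <- r | P i) l i.
Proof. by apply: cvg_big; exact: add_continuous. Qed.

(** The compactness argument behind every bound on multipliers.  If no constant
    worked, normalised coefficients along some sequence tending to [x0] would
    have combinations tending to zero; a limit of them contradicts the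
    hypothesis.  The property [Q] records what is known along that sequence. *)
Lemma bounded_multipliers (R : realType) (n q : nat) (T : finType)
    (v : 'rV[R]_n -> T -> 'rV[R]_q) (x0 : 'rV[R]_n) (A N : {set T})
    (Q : set 'rV[R]_n) :
  (forall t, {for x0, continuous (v^~ t)}) ->
  (forall (u : nat -> 'rV[R]_n) (c : T -> R),
     u @ \oo --> x0 -> (forall k, Q (u k)) ->
     (forall t, t \in N -> 0 <= c t) ->
     \sum_(t in A) c t *: v x0 t = 0 -> forall t, t \in A -> c t = 0) ->
  exists M : R, \forall x \near x0, Q x ->
    forall c : T -> R, (forall t, t \in N -> 0 <= c t) ->
      \sum_(t in A) `|c t| <= M * `|\sum_(t in A) c t *: v x t|.
Proof.
move=> hv hQ; apply: contrapT => /forallNP hM.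
have [u hu] := not_near_seq (fun k => hM k%:R).
move=> {hM} hP.
have {hP} /choice[c hc] : forall k, exists c : T -> R,
   [/\ Q (u k), (forall t, t \in N -> 0 <= c t),
     \sum_(t in A) `|c t| = 1 & k%:R * `|\sum_(t in A) c t *: v (u k) t| <= 1].
  move=> k; have /not_implyP[Qu /existsNP[c /not_implyP[cN /negP]]] := hP k.
  rewrite -ltNge => hlt.
  set S := \sum_(t in A) `|c t| in hlt.
  have S0 : 0 < S by apply: le_lt_trans hlt; rewrite mulr_ge0.
  exists (fun t => S^-1 * c t); split=> //.
  - by move=> t tN; rewrite mulr_ge0 ?cN// invr_ge0 ltW.
  - under eq_bigr do rewrite normrM (gtr0_norm (_ : 0 < S^-1)) ?invr_gt0//.
    by rewrite -mulr_sumr mulVf ?gt_eqF.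
  - under eq_bigr do rewrite -scalerA.
    rewrite -scaler_sumr normrZ (gtr0_norm (_ : 0 < S^-1)) ?invr_gt0//.
    by rewrite mulrCA ler_pdivrMl// mulr1 ltW.
(* Coefficients outside [A] are not controlled; cut them off. *)
pose d k t := if t \in A then c k t else 0.
have dA k t : t \in A -> d k t = c k t by rewrite /d => ->.
have dle k t : `|d k t| <= 1.
  rewrite /d; case: ifPn => tA; last by rewrite normr0.
  have [_ _ <- _] := hc k; rewrite (bigD1 t)//= lerDl.
  by apply: sumr_ge0 => *.
have [phi hphi [l hl]] := bolzano_weierstrass_fin dle.
have huphi : u (phi k) @[k --> \oo] --> x0.
  exact: (cvg_comp phi u (increasing_seq_cvg hphi) hu).
have l1 : \sum_(t in A) `|l t| = 1.
  have : \sum_(t in A) `|d (phi k) t| @[k --> \oo] --> \sum_(t in A) `|l t|.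
    by apply: cvg_sum => t _; apply: cvg_norm; exact: hl.
  move/cvg_lim => <- //.
  under eq_fun do under eq_bigr => t tA do rewrite dA//.
  rewrite (_ : (fun k => _) = fun=> 1) ?lim_cst//.
  by apply/funext => k; have [] := hc (phi k).
suff l0 : forall t, t \in A -> (if t \in A then l t else 0) = 0.
  have : \sum_(t in A) `|l t| = 0.
    by rewrite big1// => t tA; move: (l0 _ tA); rewrite tA => ->; rewrite normr0.
  by rewrite l1 => /eqP; rewrite oner_eq0.
apply: (hQ (u \o phi)) => //.
- by move=> k; have [] := hc (phi k).
- move=> t tN; case: ifP => // tA.
  rewrite -(cvg_lim (@Rhausdorff R) (hl t)).
  apply: limr_ge; first by apply/cvg_ex; exists (l t); exact: hl.
  near=> k.
  by rewrite dA//; have [_ /(_ t tN)] := hc (phi k).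
have W : \sum_(t in A) d (phi k) t *: v (u (phi k)) t @[k --> \oo] -->
         \sum_(t in A) l t *: v x0 t.
  apply: cvg_sum => t _; apply: cvgZ; first exact: hl.
  exact: (continuous_cvg _ (hv t) huphi).
under eq_bigr => t tA do rewrite tA.
have phi_oo := increasing_seq_cvg hphi.
move/cvg_lim : W => <- //; apply/cvg_lim => //; apply/cvgr0Pnorm_le => e e0.
near=> k; have [_ _ _ +] := hc (phi k).
under [X in _ -> `|X| <= _]eq_bigr => t tA do rewrite dA//.
have k0 : 0 < (phi k)%:R :> R.
  by near: k; exact: phi_oo (nbhs_infty_gtr 0).
rewrite -ler_pdivlMl// mulr1 => /le_trans; apply.
rewrite -[leRHS]invrK lef_pV2 ?posrE ?invr_gt0//.
by near: k; exact: phi_oo (nbhs_infty_ger e^-1).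
Unshelve. all: by end_near. Qed.

Lemma indep_open (R : realType) (n q : nat) (T : finType)
    (v : 'rV[R]_n -> T -> 'rV[R]_q) (x0 : 'rV[R]_n) (A : {set T}) :
  (forall t, {for x0, continuous (v^~ t)}) -> indep (v x0) A ->
  \forall x \near x0, indep (v x) A.
Proof.
move=> hv hA.
have [|M hM] := @bounded_multipliers _ _ _ _ v x0 A finset.set0 setT hv.
  by move=> u c _ _ _; exact: hA.
near=> x => c hc t tA; apply/eqP; rewrite -normr_le0.
apply: (@le_trans _ _ (\sum_(t in A) `|c t|)).
  by rewrite (bigD1 t)//= lerDl; apply: sumr_ge0.
have := (near hM x _) _ c; rewrite hc normr0 mulr0; apply=> //.
by move=> i; rewrite inE.
Unshelve. all: by end_near. Qed.

(** * Euclidean norm and first-order expansions *)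

Definition dotv (R : realType) (n : nat) (a b : 'rV[R]_n) : R :=
  \sum_(j < n) a ord0 j * b ord0 j.

Lemma sqr_enorm (R : realType) (n : nat) (x : 'rV[R]_n) :
  enorm x ^+ 2 = dotv x x.
Proof.
rewrite /enorm sqr_sqrtr; first by apply: eq_bigr => j _; rewrite expr2.
by apply: sumr_ge0 => j _; exact: sqr_ge0.
Qed.

Lemma enorm_ge0 (R : realType) (n : nat) (x : 'rV[R]_n) : 0 <= enorm x.
Proof. exact: sqrtr_ge0. Qed.

Lemma enormB (R : realType) (n : nat) (x y : 'rV[R]_n) :
  enorm (x - y) = enorm (y - x).
Proof.
by congr Num.sqrt; apply: eq_bigr => j _; rewrite -opprB mxE sqrrN.
Qed.

Lemma coord_le_norm (R : realType) (n : nat) (x : 'rV[R]_n) (j : 'I_n) :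
  `|x ord0 j| <= `|x|.
Proof.
rewrite [leRHS]mx_normrE.
exact: (le_bigmax _ (fun ij : 'I_1 * 'I_n => `|x ij.1 ij.2|) (ord0, j)).
Qed.

Lemma coord_le_enorm (R : realType) (n : nat) (x : 'rV[R]_n) (j : 'I_n) :
  `|x ord0 j| <= enorm x.
Proof.
rewrite -sqrtr_sqr ler_wsqrtr// (bigD1 j)//= lerDl.
by apply: sumr_ge0 => i _; exact: sqr_ge0.
Qed.

Lemma norm_le_enorm (R : realType) (n : nat) (x : 'rV[R]_n) :
  `|x| <= enorm x.
Proof.
rewrite [leLHS]mx_normrE; apply/bigmax_leP; split; first exact: enorm_ge0.
by move=> [i j] _ /=; rewrite (ord1 i); exact: coord_le_enorm.
Qed.

Lemma enorm_le_norm (R : realType) (n : nat) (x : 'rV[R]_n) :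
  enorm x <= n%:R * `|x|.
Proof.
rewrite -(@ger0_norm _ (n%:R * `|x|)) ?mulr_ge0// -sqrtr_sqr ler_wsqrtr//.
apply: (@le_trans _ _ (\sum_(j < n) `|x| ^+ 2)).
  apply: ler_sum => j _; rewrite -[leLHS]real_normK ?num_real//.
  by rewrite lerXn2r ?nnegrE// coord_le_norm.
rewrite sumr_const card_ord -[leLHS]mulr_natl exprMn ler_wpM2r ?sqr_ge0// -natrX.
by rewrite ler_nat; case: n {x} => // n; rewrite expnS leq_pmulr// expn_gt0.
Qed.

Lemma dotv_norm_le (R : realType) (n : nat) (a b : 'rV[R]_n) :
  `|dotv a b| <= n%:R * `|a| * enorm b.
Proof.
apply: le_trans (ler_norm_sum _ _ _) _.
apply: (@le_trans _ _ (\sum_(j < n) `|a| * enorm b)).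
  by apply: ler_sum => j _; rewrite normrM ler_pM// ?coord_le_norm ?coord_le_enorm.
by rewrite sumr_const card_ord -[leLHS]mulr_natl mulrA.
Qed.

Lemma dotvBl (R : realType) (n : nat) (a b d : 'rV[R]_n) :
  dotv (a - b) d = dotv a d - dotv b d.
Proof.
by rewrite -sumrB; apply: eq_bigr => j _; rewrite !mxE mulrBl.
Qed.

Lemma dotv_suml (R : realType) (n : nat) (T : finType) (A : {set T})
    (c : T -> R) (v : T -> 'rV[R]_n) (d : 'rV[R]_n) :
  dotv (\sum_(t in A) c t *: v t) d = \sum_(t in A) c t * dotv (v t) d.
Proof.
rewrite /dotv; under eq_bigr do rewrite summxE mulr_suml.
rewrite exchange_big /=; apply: eq_bigr => t _; rewrite mulr_sumr.
by apply: eq_bigr => j _; rewrite mxE mulrA.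
Qed.

Section C1_functions.
Context {R : realType} {n q : nat} {G : 'rV[R]_n -> 'rV[R]_q}.
Hypothesis hG : C1 G.

Lemma C1_grad_coord x i j : grad G x i ord0 j = 'd G x (delta_mx ord0 j) ord0 i.
Proof. by rewrite /grad !mxE. Qed.

Lemma C1_diff_dotv x i d : ('d G x d) ord0 i = dotv (grad G x i) d.
Proof.
have {1}-> : d = \sum_(j < n) d ord0 j *: delta_mx ord0 j by exact: row_sum_delta.
rewrite linear_sum summxE; apply: eq_bigr => j _.
by rewrite linearZ mxE C1_grad_coord mulrC.
Qed.

Lemma C1_grad_continuous i : continuous (fun x => grad G x i).
Proof.
move=> x; apply: (cvg_rowP (nbhs_filter x) _ _).2 => j.
under eq_fun do rewrite C1_grad_coord.
rewrite C1_grad_coord.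
apply: (continuous_cvg _ (@coord_continuous R 1 q ord0 i _)).
exact: (hG.2 (delta_mx ord0 j) x).
Qed.

Lemma C1_continuous : continuous G.
Proof. by move=> x; exact: differentiable_continuous (hG.1 x). Qed.

Lemma C1_coord_continuous i : continuous (fun x => G x ord0 i).
Proof.
move=> x.
apply: (@continuous_comp _ _ _ G (fun y : 'rV[R]_q => y ord0 i)).
  exact: C1_continuous.
exact: coord_continuous.
Qed.

Lemma C1_is_derive_line i x d (t : R) :
  is_derive t 1 (fun s : R => G (x + s *: d) ord0 i)
    (dotv (grad G (x + t *: d) i) d).
Proof.
pose l (s : R) := x + s *: d.
have dl : is_diff t l (fun s => s *: d).
  have -> : l = cst x + ( *:%R ^~ d) by [].
  by have := is_diffD (is_diff_cst x t) (is_diff_scalel t d); rewrite add0r.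
have dG : is_diff (l t) G ('d G (l t)) by apply: DiffDef => //; exact: hG.1.
have dGl : is_diff t (G \o l) ('d G (l t) \o (fun s => s *: d)).
  exact: is_diff_comp.
have Gl : derivable (G \o l) t 1 by apply: diff_derivable; exact: ex_diff.
have Gli : derivable (fun s : R => G (l s) ord0 i) t 1.
  exact: ((derivable_mxP _ _ _).1 Gl ord0 i).
apply: DeriveDef => //.
have := derive_mx Gl; rewrite deriveE; last exact: ex_diff.
rewrite diff_val /= scale1r => /(congr1 (fun w : 'rV[R]_q => w ord0 i)).
by rewrite mxE C1_diff_dotv => ->.
Qed.

(** Mean value theorem on the segment from [x] to [y], which stays in the ball
    by convexity; continuity of the gradient makes the error uniform. *)
Lemma C1_first_order i (x0 : 'rV[R]_n) (e : R) : 0 < e ->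
  exists2 r : R, 0 < r & forall x y, `|x - x0| < r -> `|y - x0| < r ->
    `|G y ord0 i - G x ord0 i - dotv (grad G x i) (y - x)|
       <= e * enorm (y - x).
Proof.
move=> e0.
pose e' := e / (2 * n.+1%:R).
have e'0 : 0 < e' by rewrite divr_gt0// mulr_gt0.
have /cvgrPdist_lt/(_ e' e'0) := @C1_grad_continuous i x0.
move=> /nbhs_ballP[r /= r0 hr]; exists r => // x y xr yr.
have hgrad z : `|z - x0| < r -> `|grad G x0 i - grad G z i| < e'.
  by move=> zr; apply: hr; rewrite -ball_normE /= distrC.
pose phi (s : R) : R := G (x + s *: (y - x)) ord0 i.
pose dphi (s : R) := dotv (grad G (x + s *: (y - x)) i) (y - x).
have hphi (s : R) : is_derive s (1 : R) phi (dphi s) by exact: C1_is_derive_line.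
have [|s s01 hs] := @MVT_segment R phi dphi 0 1 ler01 (fun s _ => hphi s).
  apply: derivable_within_continuous => s _; exact: ex_derive.
have -> : G y ord0 i - G x ord0 i = dphi s.
  have e1 : x + (1 : R) *: (y - x) = y by rewrite scale1r addrC subrK.
  by move: hs; rewrite /phi e1 scale0r addr0 subr0 mulr1.
rewrite /dphi -dotvBl (le_trans (dotv_norm_le _ _))// ler_wpM2r ?enorm_ge0//.
have hz : `|x + s *: (y - x) - x0| < r.
  have -> : x + s *: (y - x) - x0 = (1 - s) *: (x - x0) + s *: (y - x0).
    rewrite scalerBl scale1r !scalerBr; apply/rowP => j; rewrite !mxE; ring.
  move: s01; rewrite in_itv /= => /andP[s0 s1].
  rewrite (le_lt_trans (ler_normD _ _))// !normrZ (ger0_norm s0).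
  rewrite (ger0_norm (_ : 0 <= 1 - s)) ?subr_ge0//.
  set a := `|x - x0| in xr *; set b := `|y - x0| in yr *.
  have hm : Num.max a b < r by rewrite gt_max xr.
  apply: le_lt_trans hm.
  have ha : (1 - s) * a <= (1 - s) * Num.max a b.
    by rewrite ler_wpM2l ?subr_ge0// le_max lexx.
  have hb : s * b <= s * Num.max a b by rewrite ler_wpM2l// le_max lexx orbT.
  lra.
have hd : `|grad G (x + s *: (y - x)) i - grad G x i| <= e' + e'.
  apply: le_trans (ler_distD (grad G x0 i) _ _) _; apply: lerD.
    by rewrite distrC ltW// hgrad.
  by rewrite ltW// hgrad.
apply: (@le_trans _ _ (n%:R * (e' + e'))); first exact: ler_wpM2l hd.
rewrite (_ : n%:R * (e' + e') = n%:R / n.+1%:R * e); last first.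
  have : n.+1%:R != 0 :> R by rewrite pnatr_eq0.
  by rewrite /e'; move: (n.+1%:R : R) => N hN; field.
by rewrite ler_piMl ?ltW// ltr_pdivrMr ?mul1r ?ltr_nat ?ltr0n.
Qed.

End C1_functions.

(** * From the constraint qualifications to a local basis *)

(** All vectors that may occur in a multiplier combination, as one family, so
    that independence and reduction arguments need not distinguish them. *)
Definition cvec (R : realType) (n m p : nat)
    (g : 'rV[R]_n -> 'rV[R]_m) (h : 'rV[R]_n -> 'rV[R]_p) (x : 'rV[R]_n)
    (t : 'I_m + 'I_p + 'I_n) : 'rV[R]_n :=
  match t with
  | inl (inl i) => grad g x i
  | inl (inr j) => grad h x j
  | inr k => delta_mx ord0 k
  end.

Definition csel (n m p : nat) (I : {set 'I_m}) (J : {set 'I_p})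
    (K : {set 'I_n}) : {set 'I_m + 'I_p + 'I_n} :=
  [set t | match t with
           | inl (inl i) => i \in I
           | inl (inr j) => j \in J
           | inr k => k \in K
           end]%SET.

Lemma sum_csel (V : zmodType) (n m p : nat) (I : {set 'I_m}) (J : {set 'I_p})
    (K : {set 'I_n}) (F : 'I_m + 'I_p + 'I_n -> V) :
  \sum_(t in csel I J K) F t =
  \sum_(i in I) F (inl (inl i)) + \sum_(j in J) F (inl (inr j))
    + \sum_(k in K) F (inr k).
Proof.
rewrite big_sumType big_sumType /=.
by congr (_ + _ + _); apply: eq_bigl => i; rewrite inE.
Qed.

Section Families.
Context {R : realType} {n m p s : nat}.
Context {g : 'rV[R]_n -> 'rV[R]_m} {h : 'rV[R]_n -> 'rV[R]_p}.
Implicit Types (I : {set 'I_m}) (J : {set 'I_p}) (K : {set 'I_n}).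
Implicit Types (x xs eta : 'rV[R]_n).

Lemma family_at_indep I J K x :
  free (family_at g h I J K x) <-> indep (cvec g h x) (csel I J K).
Proof.
pose S : seq ('I_m + 'I_p + 'I_n) := map (inl \o inl) (enum I) ++
  map (inl \o inr) (enum J) ++ map inr (enum K).
have -> : family_at g h I J K x = map (cvec g h x) S.
  by rewrite !map_cat -!map_comp.
have iLL : injective (inl \o inl : 'I_m -> 'I_m + 'I_p + 'I_n) by move=> ? ? [].
have iLR : injective (inl \o inr : 'I_p -> 'I_m + 'I_p + 'I_n) by move=> ? ? [].
have iR : injective (inr : 'I_n -> 'I_m + 'I_p + 'I_n) by move=> ? ? [].
have uS : uniq S.
  rewrite !cat_uniq !map_inj_uniq// !enum_uniq /= !andbT.
  apply/andP; split.
    apply/hasPn => t; rewrite mem_cat => /orP[] /mapP[i _ ->]; apply/mapP => -[j _] //.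
  by apply/hasPn => t /mapP[i _ ->]; apply/mapP => -[j _].
rewrite free_map_indep//.
suff -> : [set t in S]%SET = csel I J K by [].
apply/setP => -[[i|j]|k]; rewrite !inE !mem_cat.
- rewrite (mem_map iLL) mem_enum; case: (i \in I) => //=.
  by apply/negbTE/negP => /orP[] /mapP[].
- rewrite (mem_map iLR) mem_enum; case: (j \in J); rewrite ?orbT//=.
  by apply/negbTE/negP; rewrite ?orbF => /orP[] /mapP[].
- rewrite (mem_map iR) mem_enum; case: (k \in K); rewrite ?orbT//=.
  by apply/negbTE/negP; rewrite ?orbF => /orP[] /mapP[].
Qed.

Lemma size_family_at I J K x : size (family_at g h I J K x) = (#|I| + #|J| + #|K|)%N.
Proof.
rewrite (size_cat (grad_family g I x)) (size_cat (grad_family h J x)) addnA.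
by congr (_ + _ + _)%N; exact: size_image.
Qed.

Lemma free_family_at I J K x : free (family_at g h I J K x) =
  (\dim <<family_at g h I J K x>>%VS == (#|I| + #|J| + #|K|)%N).
Proof. by rewrite /free size_family_at. Qed.

Lemma sum_unit_support eta K : Ipm eta \subset K ->
  \sum_(k in K) eta ord0 k *: (delta_mx ord0 k : 'rV[R]_n) = eta.
Proof.
move=> hK; rewrite {2}(row_sum_delta eta) big_mkcond; apply: eq_bigr => k _.
case: ifPn => // kK; have : k \notin Ipm eta by apply: contra kK; exact/fintype.subsetP.
by rewrite inE negbK => /eqP ->; rewrite scale0r.
Qed.

Lemma condK_support xs eta K : condK s xs eta K -> Ipm eta \subset K.
Proof.
move=> [hK0 hK1]; have [->|/hK0[]//] := eqVneq eta 0.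
by apply/fintype.subsetP => i; rewrite !inE mxE eqxx.
Qed.

Lemma row_neq0_coord (q : nat) (z : 'rV[R]_q) : z != 0 -> exists k, z ord0 k != 0.
Proof.
move=> e0; apply: contrapT => /forallNP he; move/eqP: e0; apply.
by apply/rowP => k; rewrite mxE; apply/eqP/negPn/negP => /(he k).
Qed.

Lemma combination_dependent I J K x (lg : 'I_m -> R) (lh : 'I_p -> R) eta :
  [\/ exists2 i, i \in I & lg i != 0, exists2 j, j \in J & lh j != 0
    | eta != 0] ->
  Ipm eta \subset K ->
  \sum_(i in I) lg i *: grad g x i + \sum_(j in J) lh j *: grad h x j + eta = 0 ->
  ~~ free (family_at g h I J K x).
Proof.
move=> nz hK e; apply/negP => /family_at_indep hf.
pose c (t : 'I_m + 'I_p + 'I_n) := match t with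
  | inl (inl i) => lg i | inl (inr j) => lh j | inr k => eta ord0 k end.
have c0 : forall t, t \in csel I J K -> c t = 0.
  by apply: hf; rewrite sum_csel /= sum_unit_support.
case: nz => [[i iI]|[j jJ]|/row_neq0_coord[k ek]].
- by have /= := c0 (inl (inl i)); rewrite inE => ->//; rewrite eqxx.
- by have /= := c0 (inl (inr j)); rewrite inE => ->//; rewrite eqxx.
- have /= := c0 (inr k); rewrite inE => ek0; move/eqP: (ek); apply; apply: ek0.
  by apply: (fintype.subsetP hK); rewrite inE.
Qed.

(** A dependent family does not have full rank, and CRCQ carries this over to
    the nearby points of the sequence. *)
Lemma crcq_at_cpld_at xs J : crcq_at s g h xs J -> cpld_at s g h xs J.
Proof.
move=> hC I lg lh eta hI nz lg0 hE e u K hu hK.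
have nf := combination_dependent nz (condK_support hK) e.
have := hC I eta K u hI hE hK hu; apply: filterS => k ek.
apply/negP => fk; move/negP: nf; apply.
by rewrite free_family_at ek -free_family_at.
Qed.

(** The premise of the CPLD implication is contradictory here: the multipliers,
    extended by zero, violate NNAMCQ. *)
Lemma nnamcq_cpld_at xs J : ccop_nnamcq s g h xs -> cpld_at s g h xs J.
Proof.
move=> hN I lg lh eta hI nz lg0 hE e; exfalso; apply: hN.
exists (\row_i if i \in I then lg i else 0), (\row_j if j \in J then lh j else 0), eta.
split.
  move=> [/rowP h1 /rowP h2 h3]; case: nz => [[i iI]|[j jJ]|].
  - by have := h1 i; rewrite !mxE iI => ->; rewrite eqxx.
  - by have := h2 j; rewrite !mxE jJ => ->; rewrite eqxx.
  - by rewrite h3 eqxx.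
split=> //.
- by move=> i _; rewrite mxE; case: ifP => // /lg0.
- move=> i iA; rewrite mxE; case: ifPn => // iI.
  by move: iA; rewrite (fintype.subsetP hI i iI).
- rewrite -[RHS]e; congr (_ + _ + _).
    rewrite big_mkcond [RHS]big_mkcond; apply: eq_bigr => i _; rewrite mxE.
    case: (boolP (i \in I)) => [/(fintype.subsetP hI) -> //|_].
    by rewrite scale0r if_same.
  rewrite [RHS]big_mkcond; apply: eq_bigr => j _; rewrite mxE.
  by case: ifP => // _; rewrite scale0r.
Qed.

Lemma licq_nnamcq xs : ccop_licq g h xs -> ccop_nnamcq s g h xs.
Proof.
move=> hL [lg [lh [eta [nz [lg0 lg1 [hE _] e]]]]].
move: hL; rewrite /ccop_licq; apply/negP.
apply: (combination_dependent (lg := lg ord0) (lh := lh ord0) (eta := eta)).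
- have [eta0|] := eqVneq eta 0; last by constructor 3.
  have [lh0|/row_neq0_coord[j]] := eqVneq lh 0; last by constructor 2; exists j.
  constructor 1; apply: contrapT => lgn; apply: nz; rewrite eta0 lh0.
  congr (_, _, _); apply/rowP => i; rewrite mxE.
  have [iA|/lg1//] := boolP (i \in active g xs).
  by apply/eqP/negPn/negP => lgi; apply: lgn; exists i.
- apply/fintype.subsetP => k; rewrite !inE => ek; apply/negPn/negP => xk.
  by move: ek; rewrite hE ?eqxx// inE.
- by rewrite -[RHS]e; congr (_ + _ + _); apply: eq_bigl => j; rewrite inE.
Qed.

End Families.

Lemma sum_nth_map (F : nzRingType) (V : lmodType F) (T : eqType)
    (c : T -> F) (v : T -> V) (r : seq T) :
  \sum_(i < size (map v r)) (map c r)`_i *: (map v r)`_i =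
  \sum_(t <- r) c t *: v t.
Proof.
case: r => [|a r]; first by rewrite big_ord0 big_nil.
rewrite (big_nth a) big_mkord size_map; apply: eq_bigr => i _.
by rewrite !(nth_map a).
Qed.

(** The consequence of the constraint qualifications that the error bound uses.
    The index set [J] may depend on [x]. *)
Definition cpld_basis_at (R : realType) (n m p s : nat)
    (g : 'rV[R]_n -> 'rV[R]_m) (h : 'rV[R]_n -> 'rV[R]_p) (xs x : 'rV[R]_n) :
    Prop :=
  exists J : {set 'I_p},
    [/\ cpld_at s g h xs J, free (grad_family h J x)
      & <<grad_family h J x>>%VS = <<grad_family h [set: 'I_p]%SET x>>%VS].

Section Reductions.
Context {R : realType} {n m p s : nat}.
Context {g : 'rV[R]_n -> 'rV[R]_m} {h : 'rV[R]_n -> 'rV[R]_p}.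
Implicit Types (I : {set 'I_m}) (J : {set 'I_p}) (K : {set 'I_n}).
Implicit Types (x xs eta : 'rV[R]_n).

(** The premise of RCPLD entails that of ERCPLD, because [eta] is spread over
    the unit vectors indexed by [K]. *)
Lemma combination_pos_lin_dep I J K x (lg : 'I_m -> R) (lh : 'I_p -> R) eta :
  [\/ exists2 i, i \in I & lg i != 0, exists2 j, j \in J & lh j != 0
    | eta != 0] ->
  (forall i, i \in I -> 0 <= lg i) -> Ipm eta \subset K ->
  \sum_(i in I) lg i *: grad g x i + \sum_(j in J) lh j *: grad h x j + eta = 0 ->
  pos_lin_dep (grad_family g I x) (grad_family h J x ++ unit_family R K).
Proof.
move=> nz lg0 hK e.
pose r : seq ('I_p + 'I_n) := map inl (enum J) ++ map inr (enum K).
pose w t := cvec g h x (match t with inl j => inl (inr j) | inr k => inr k end).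
pose d (t : 'I_p + 'I_n) := match t with inl j => lh j | inr k => eta ord0 k end.
have -> : grad_family h J x ++ unit_family R K = map w r.
  by rewrite map_cat -!map_comp.
have hd t : t \in r -> d t != 0 -> exists j : 'I_(size (map w r)), (map d r)`_j != 0.
  move=> tr dt; have it : (index t r < size (map w r))%N by rewrite size_map index_mem.
  by exists (Ordinal it); rewrite /= (nth_map t) ?index_mem// nth_index.
exists (fun i => (map lg (enum I))`_i), (fun j => (map d r)`_j); split.
- move=> i; have : (i < size (enum I))%N by rewrite -(size_map (grad g x)).
  case: i => i /= _; case E : (enum I) => [|a l] // il; rewrite -E in il *.
  by rewrite (nth_map a)// lg0// -mem_enum mem_nth.
- case: nz => [[i iI li]|[j jJ lj]|/row_neq0_coord[k ek]].
  + have it : (index i (enum I) < size (grad_family g I x))%N.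
      by rewrite size_map index_mem mem_enum.
    left; exists (Ordinal it).
    by rewrite /= (nth_map i) ?index_mem ?mem_enum// nth_index ?mem_enum.
  + by right; apply: (hd (inl j)) => //; rewrite mem_cat map_f// mem_enum.
  + right; apply: (hd (inr k)) => //; rewrite mem_cat map_f ?orbT// mem_enum.
    by apply: (fintype.subsetP hK); rewrite inE.
- rewrite -[RHS]e (sum_nth_map lg (grad g x)) (sum_nth_map d w) -addrA.
  rewrite big_enum; congr (_ + _); rewrite big_cat !big_map !big_enum /=.
  by rewrite sum_unit_support.
Qed.

Lemma ercpld_rcpld xs : ccop_ercpld s g h xs -> ccop_rcpld s g h xs.
Proof.
move=> [hr hJ]; split=> // J bJ I lg lh eta hI nz lg0 hE e u K hu hK.
apply: hJ (hu) => //; [exact: hE|exact: hK|].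
exact: (combination_pos_lin_dep nz lg0 (condK_support hK) e).
Qed.

Lemma norm_lt_eball xs x r : 0 < r -> `|x - xs| < r / n.+1%:R -> eball xs r x.
Proof.
move=> r0; rewrite ltr_pdivlMr// => hx.
apply: le_lt_trans (enorm_le_norm _) _; apply: le_lt_trans hx.
by rewrite mulrC ler_wpM2l// ler_nat.
Qed.

(** The instance of RCRCQ with no inequality gradient and no unit vector is
    constancy of the rank along sequences. *)
Lemma rcrcq_const_rank xs : ccop_rcrcq s g h xs -> const_rank_eq h xs.
Proof.
move=> hC; apply: contrapT => nR.
pose P x := \dim <<grad_family h [set: 'I_p]%SET x>>%VS
      = \dim <<grad_family h [set: 'I_p]%SET xs>>%VS.
have nnear : forall k : nat, ~ \forall x \near xs, P x.
  move=> _ /nbhs_ballP[r /= r0 hr]; apply: nR; exists r; first exact: r0.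
  move=> x hx; have hb : ball xs r x.
    by rewrite -ball_normE /= distrC; exact: le_lt_trans (norm_le_enorm _) hx.
  exact: (hr x hb).
have [u uxs hu] := not_near_seq nnear.
have hc : approaching xs u.
  by split=> // k; apply/eqP => e; apply: (hu k); rewrite /P e.
have h0 : condE s xs (0 : 'rV[R]_n).
  split=> [i _|]; first by rewrite mxE.
  rewrite /norm0 (_ : Ipm _ = finset.set0) ?cards0//.
  by apply/setP => i; rewrite !inE mxE eqxx.
have hK : condK s xs (0 : 'rV[R]_n) finset.set0 by split=> //; rewrite eqxx.
have famE x : family_at g h finset.set0 [set: 'I_p]%SET finset.set0 x =
    grad_family h [set: 'I_p]%SET x.
  by rewrite /family_at /unit_family /grad_family /image_mem !enum_set0 /= cats0.
have := hC finset.set0 0 finset.set0 u (finset.sub0set _) h0 hK hc.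
move=> /filter_ex[k]; rewrite (famE xs) (famE (u k)) => ek; exact: (hu k (esym ek)).
Qed.

(** At [xs] the basis [J] has the span of all equality gradients, so the family
    with [J] and the one with all of them have the same, deficient, rank there;
    nearby the larger family keeps that rank and the smaller cannot exceed it. *)
Lemma rcrcq_rcpld xs : ccop_rcrcq s g h xs -> ccop_rcpld s g h xs.
Proof.
move=> hC; split; first exact: rcrcq_const_rank.
move=> J bJ I lg lh eta hI nz lg0 hE e u K hu hK.
have nf := combination_dependent nz (condK_support hK) e.
have spanE : <<family_at g h I [set: 'I_p]%SET K xs>>%VS = <<family_at g h I J K xs>>%VS.
  by rewrite !span_cat (span_basis bJ).
have := hC I eta K u hI hE hK hu; apply: filterS => k ek.
apply/negP => fk; move/negP: nf; apply.
rewrite free_family_at eqn_leq -{1}(@size_family_at R n m p g h I J K xs) dim_span /= -spanE ek.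
move: fk; rewrite free_family_at => /eqP <-; apply: dimvS; rewrite !span_cat.
apply: addvS (subvv _) (addvS _ (subvv _)); apply: sub_span => v /mapP[j _ ->].
by apply: map_f; rewrite mem_enum inE.
Qed.

(** Under CPLD any basis at [x] will do.  Under RCPLD a basis [J] at [xs]
    remains independent nearby, and remains spanning because the rank does not
    grow. *)
Lemma cq_cpld_basis xs : C1 h ->
  ccop_licq g h xs \/ ccop_nnamcq s g h xs \/ ccop_crcq s g h xs \/
  ccop_rcrcq s g h xs \/ ccop_cpld s g h xs \/
  ccop_ercpld s g h xs \/ ccop_rcpld s g h xs ->
  \forall x \near xs, cpld_basis_at s g h xs x.
Proof.
move=> hh hCQ.
have [hC|[hr hC]] : ccop_cpld s g h xs \/ ccop_rcpld s g h xs.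
  case: hCQ => [|[|[|[|[|[|]]]]]] hC.
  - by left=> J; apply/nnamcq_cpld_at/licq_nnamcq.
  - by left=> J; exact: nnamcq_cpld_at.
  - by left=> J; apply/crcq_at_cpld_at/hC.
  - by right; exact: rcrcq_rcpld.
  - by left.
  - by right; exact: ercpld_rcpld.
  - by right.
- near=> x; have [J [fJ sJ]] := exists_image_basis (grad h x).
  by exists J; split.
have [J [fJ sJ]] := exists_image_basis (grad h xs).
have bJ : eq_basis h xs J by rewrite /eq_basis /basis_of fJ andbT; apply/eqP.
have hcont j : {for xs, continuous (fun x => grad h x j)}.
  exact: C1_grad_continuous.
have /(indep_open hcont) : indep (grad h xs) J by exact/free_image_indep.
case: hr => r r0 hr.
have : \forall x \near xs, eball xs r x.
  have r1 : 0 < r / n.+1%:R by rewrite divr_gt0.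
  apply/nbhs_ballP; exists (r / n.+1%:R) => //= x.
  by rewrite -ball_normE /= distrC => hx; exact: norm_lt_eball.
apply: filterS2 => x hx ix.
have fx : free (grad_family h J x) by exact/free_image_indep.
exists J; split; [exact: hC|exact: fx|].
apply/eqP; rewrite eqEdim; apply/andP; split.
  apply: sub_span => v /mapP[j _ ->]; apply: map_f.
  by rewrite mem_enum inE.
move: fx; rewrite /free => /eqP ->; rewrite (hr x hx).
move: fJ sJ; rewrite /free => /eqP fJ sJ; rewrite /grad_family -sJ fJ.
have szJ z : size [seq grad h z i | i in J] = #|J| by exact: size_image.
by apply: eq_leq; exact: etrans (szJ xs) (esym (szJ x)).
Unshelve. all: by end_near. Qed.

End Reductions.

(** * Uniformly bounded multipliers *)

Definition multiplier_bound (R : realType) (n m p s : nat)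
    (g : 'rV[R]_n -> 'rV[R]_m) (h : 'rV[R]_n -> 'rV[R]_p) (xs : 'rV[R]_n)
    (M : R) (x : 'rV[R]_n) : Prop :=
  forall (I : {set 'I_m}) (J : {set 'I_p}) (K : {set 'I_n}),
    cpld_at s g h xs J -> I \subset active g xs -> K \subset I0 xs ->
    (#|K| <= n - s)%N -> indep (cvec g h x) (csel I J K) ->
    forall c : 'I_m + 'I_p + 'I_n -> R,
    (forall i, i \in I -> 0 <= c (inl (inl i))) ->
    \sum_(t in csel I J K) `|c t|
      <= M * `|\sum_(t in csel I J K) c t *: cvec g h x t|.

Section Multipliers.
Context {R : realType} {n m p s : nat}.
Context {g : 'rV[R]_n -> 'rV[R]_m} {h : 'rV[R]_n -> 'rV[R]_p}.
Hypotheses (hg : C1 g) (hh : C1 h).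
Implicit Types (I : {set 'I_m}) (J : {set 'I_p}) (K : {set 'I_n}).
Implicit Types (x xs eta : 'rV[R]_n).

Lemma cvec_continuous xs t : {for xs, continuous (fun x => cvec g h x t)}.
Proof.
case: t => [[i|j]|k] /=; [exact: C1_grad_continuous|exact: C1_grad_continuous|].
exact: cst_continuous.
Qed.

Lemma csel_sub I I' J J' K K' : I \subset I' -> J \subset J' -> K \subset K' ->
  csel I J K \subset csel I' J' K'.
Proof.
move=> /fintype.subsetP sI /fintype.subsetP sJ /fintype.subsetP sK.
by apply/fintype.subsetP => -[[i|j]|k]; rewrite !inE; [exact: sI|exact: sJ|exact: sK].
Qed.

(** A nonzero limit combination at [xs] meets the premise of CPLD, whose
    conclusion denies independence along the sequence itself.  The sequence
    avoids [xs] because the family is dependent there. *)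
Lemma cpld_bounded_multipliers xs I J K :
  cpld_at s g h xs J -> I \subset active g xs -> K \subset I0 xs ->
  (#|K| <= n - s)%N ->
  exists M : R, \forall x \near xs, indep (cvec g h x) (csel I J K) ->
    forall c, (forall i, i \in I -> 0 <= c (inl (inl i))) ->
    \sum_(t in csel I J K) `|c t|
      <= M * `|\sum_(t in csel I J K) c t *: cvec g h x t|.
Proof.
move=> hJ hI hK cK.
have [M hM] : exists M : R, \forall x \near xs, indep (cvec g h x) (csel I J K) ->
    forall c, (forall t, t \in csel I finset.set0 finset.set0 -> 0 <= c t) ->
    \sum_(t in csel I J K) `|c t|
      <= M * `|\sum_(t in csel I J K) c t *: cvec g h x t|.
  apply: bounded_multipliers => [|u c uxs hu cI hc t tA].
    exact: cvec_continuous.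
  apply: contrapT => /eqP ct.
  pose eta : 'rV[R]_n := \row_k (if k \in K then c (inr k) else 0).
  have etaK : Ipm eta \subset K.
    apply/fintype.subsetP => k; rewrite !inE mxE; case: ifP => //.
    by rewrite eqxx.
  have ndep : ~ indep (cvec g h xs) (csel I J K).
    by move=> /(_ c hc t tA)/eqP; exact/negP.
  have hap : approaching xs u.
    by split=> // k; apply/eqP => e; apply: ndep; rewrite -e; exact: hu.
  have hE : condE s xs eta.
    split.
      move=> i; rewrite inE mxE => xi; case: ifP => // /(fintype.subsetP hK).
      by rewrite inE (negbTE xi).
    exact: leq_trans (subset_leq_card etaK) cK.
  have nz : [\/ exists2 i, i \in I & c (inl (inl i)) != 0,
       exists2 j, j \in J & c (inl (inr j)) != 0 | eta != 0].
    case: t tA ct => [[i|j]|k]; rewrite inE => tA ct.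
    - by constructor 1; exists i.
    - by constructor 2; exists j.
    - constructor 3; apply: contra ct => /eqP/rowP/(_ k).
      by rewrite !mxE tA => ->.
  have comb : \sum_(i in I) c (inl (inl i)) *: grad g xs i
      + \sum_(j in J) c (inl (inr j)) *: grad h xs j + eta = 0.
    rewrite -[RHS]hc sum_csel; congr (_ + _).
    rewrite -[LHS](sum_unit_support etaK); apply: eq_bigr => k kK.
    by rewrite mxE kK.
  (* The condition on [K] forces the empty set when [eta] vanishes; independence
     of the smaller family is inherited. *)
  pose K' := if eta == 0 then finset.set0 else K.
  have hK' : condK s xs eta K'.
    rewrite /K'; case: eqP => [->|/eqP e0]; split => //.
    - by rewrite eqxx.
    - by move=> e; rewrite e eqxx in e0.
  have cI' i : i \in I -> 0 <= c (inl (inl i)) by move=> iI; apply: cI; rewrite inE.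
  have := hJ I (fun i => c (inl (inl i))) (fun j => c (inl (inr j))) eta hI nz cI' hE
    comb u K' hap hK'.
  move=> /filter_ex[k] /negP; apply; apply/family_at_indep.
  apply: indepS (hu k); apply: csel_sub => //.
  by rewrite /K'; case: ifP => // _; exact: finset.sub0set.
exists M; apply: filterS hM => x hx ix c c0; apply: hx => // -[[i|j]|k]; rewrite !inE //.
exact: c0.
Qed.

(** There are finitely many triples of index sets, so the sum of their constants
    serves all of them. *)
Lemma uniform_bounded_multipliers xs :
  exists2 M : R, 0 < M & \forall x \near xs, multiplier_bound s g h xs M x.
Proof.
have /choice[M hM] : forall q : {set 'I_m} * {set 'I_p} * {set 'I_n},
    exists M : R, \forall x \near xs,
    cpld_at s g h xs q.1.2 -> q.1.1 \subset active g xs -> q.2 \subset I0 xs ->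
    (#|q.2| <= n - s)%N -> indep (cvec g h x) (csel q.1.1 q.1.2 q.2) ->
    forall c, (forall i, i \in q.1.1 -> 0 <= c (inl (inl i))) ->
    \sum_(t in csel q.1.1 q.1.2 q.2) `|c t|
      <= M * `|\sum_(t in csel q.1.1 q.1.2 q.2) c t *: cvec g h x t|.
  move=> [[I J] K] /=.
  have [hJ|nJ] := pselect (cpld_at s g h xs J); last by exists 0; near=> x.
  have [hI|nI] := boolP (I \subset active g xs); last by exists 0; near=> x.
  have [hK|nK] := boolP (K \subset I0 xs); last by exists 0; near=> x.
  have [cK|cK] := boolP (#|K| <= n - s)%N; last by exists 0; near=> x.
  have [M hM] := cpld_bounded_multipliers hJ hI hK cK.
  by exists M; apply: filterS hM => x hx _ _ _ _; exact: hx.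
have hS q : M q <= 1 + \sum_q `|M q|.
  rewrite (bigD1 q)//= (le_trans (ler_norm _))// addrCA lerDl addr_ge0//.
  by apply: sumr_ge0.
exists (1 + \sum_q `|M q|); first by rewrite ltr_pwDl// sumr_ge0.
have := @filter_forall _ _ _ _ (nbhs_filter xs) hM; apply: filterS => x hx I J K.
move=> hJ hI hK cK hi c c0; apply: le_trans (hx (I, J, K) hJ hI hK cK hi c c0) _.
by apply: ler_wpM2r.
Unshelve. all: by end_near. Qed.

End Multipliers.

(** * Minimisers of the quadratic penalty *)

Definition penalty (R : realType) (n m p : nat)
    (g : 'rV[R]_n -> 'rV[R]_m) (h : 'rV[R]_n -> 'rV[R]_p) (x : 'rV[R]_n) : R :=
  \sum_(i < m) Num.max (g x ord0 i) 0 ^+ 2 + \sum_(j < p) h x ord0 j ^+ 2.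

(** A quadratic upper model of the squared positive part.  Being smooth in [b]
    and exact at [b = a], it can replace that function in first-order
    conditions at a minimum. *)
Lemma sqr_max_le (R : realDomainType) (a b : R) :
  Num.max b 0 ^+ 2 <= Num.max a 0 ^+ 2 + (2 * Num.max a 0 * (b - a) + (b - a) ^+ 2).
Proof.
have h1 := sqr_ge0 (b - a); have h2 := sqr_ge0 b; have h3 := sqr_ge0 a.
case: (leP b 0) => hb; case: (leP a 0) => ha.
- by rewrite expr0n mulr0 mul0r !add0r.
- by rewrite expr0n; apply: le_trans h2 _; rewrite le_eqVlt; apply/orP; left; apply/eqP; ring.
- rewrite expr0n mulr0 mul0r !add0r.
  have : 0 <= b * - a by rewrite mulr_ge0 ?oppr_ge0// ltW.
  by move=> h4; nra.
- by rewrite le_eqVlt; apply/orP; left; apply/eqP; ring.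
Qed.

Lemma is_derive_quadratic (R : realType) (a : R -> R) (t da C a0 : R) :
  is_derive t (1 : R) a da ->
  is_derive t (1 : R) (fun s => C * (a s - a0) + (a s - a0) ^+ 2)
    ((C + 2 * (a t - a0)) * da).
Proof.
move=> ha.
have e : (fun s => C * (a s - a0) + (a s - a0) ^+ 2) =
    (C \*: (a - cst a0)) + (a - cst a0) ^+ 2.
  by apply/funext => u; rewrite fctE exprfctE.
rewrite e; apply: is_derive_eq.
by rewrite /= /GRing.scale /= subr0 expr1 [RHS]mulrDl.
Qed.

Lemma is_derive_fsum (R : realType) (k : nat) (F : 'I_k -> R -> R) (t : R)
    (dF : 'I_k -> R) :
  (forall i, is_derive t (1 : R) (F i) (dF i)) ->
  is_derive t (1 : R) (fun s => \sum_(i < k) F i s) (\sum_(i < k) dF i).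
Proof.
move=> hF; have := is_derive_sum hF.
by rewrite (_ : \sum_(i < k) F i = fun s => \sum_(i < k) F i s)//; apply/funext => s; rewrite fct_sumE.
Qed.

Definition coord_subspace (R : realType) (n : nat) (T : {set 'I_n}) :
    set 'rV[R]_n :=
  [set x | forall k, k \in T -> x ord0 k = 0].

Lemma continuous_fsum (R : realType) (U : topologicalType) (I : finType)
    (F : I -> U -> R) :
  (forall i, continuous (F i)) -> continuous (fun x => \sum_i F i x).
Proof. by move=> hF x; apply: cvg_sum => i _; exact: hF. Qed.

Lemma continuous_fsqr (R : realType) (U : topologicalType) (f : U -> R) :
  continuous f -> continuous (fun x => f x ^+ 2).
Proof. by move=> hf x; apply: cvgM; exact: hf. Qed.

Section Penalty.
Context {R : realType} {n m p : nat}.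
Context {g : 'rV[R]_n -> 'rV[R]_m} {h : 'rV[R]_n -> 'rV[R]_p}.
Hypotheses (hg : C1 g) (hh : C1 h).

Lemma penalty_continuous : continuous (penalty g h).
Proof.
have cg : continuous (fun x => \sum_(i < m) Num.max (g x ord0 i) 0 ^+ 2).
  apply: continuous_fsum => i; apply: continuous_fsqr => x.
  apply: continuous_max; [exact: C1_coord_continuous|exact: cst_continuous].
have ch : continuous (fun x => \sum_(j < p) h x ord0 j ^+ 2).
  by apply: continuous_fsum => j; apply: continuous_fsqr; exact: C1_coord_continuous.
by move=> x; exact: cvgD (cg x) (ch x).
Qed.

Lemma coord_subspace_closed (T : {set 'I_n}) :
  closed (@coord_subspace R n T).
Proof.
have -> : @coord_subspace R n T =
   \bigcap_(k in [set k | k \in T]) (fun x : 'rV[R]_n => x ord0 k) @^-1` [set 0].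
  by apply/seteqP; split=> x hx k kT; exact: hx.
apply: closed_bigI => k _; apply: closed_comp; last exact: closed_eq.
by move=> x _; exact: coord_continuous.
Qed.

Lemma sqdist_continuous (y : 'rV[R]_n) :
  continuous (fun x : 'rV[R]_n => \sum_(j < n) (x ord0 j - y ord0 j) ^+ 2).
Proof.
apply: continuous_fsum => j; apply: continuous_fsqr => x.
exact: cvgB (@coord_continuous R 1 n ord0 j x) (cvg_cst _).
Qed.

Lemma enormB_sqr (x y : 'rV[R]_n) :
  enorm (x - y) ^+ 2 = \sum_(j < n) (x ord0 j - y ord0 j) ^+ 2.
Proof.
by rewrite sqr_enorm; apply: eq_bigr => j _; rewrite !mxE expr2.
Qed.

Lemma penalty_ge0 x : 0 <= penalty g h x.
Proof. by apply: addr_ge0; apply: sumr_ge0 => i _; exact: sqr_ge0. Qed.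

(** [x] minimises the squared distance to [y] plus [k] times the penalty over
    the points of the subspace within sup-norm distance [enorm (xs - y) + 1] of
    [y].  Comparison with [xs], where the penalty vanishes, shows that [x] is no
    farther from [y] than [xs] is; so the distance bound is inactive at [x] and
    the derivative vanishes along every free coordinate. *)
Lemma penalty_minimizer (T : {set 'I_n}) (xs y : 'rV[R]_n) (k : R) :
  coord_subspace T xs -> coord_subspace T y -> penalty g h xs = 0 -> 0 <= k ->
  exists x, [/\ coord_subspace T x,
    enorm (x - y) <= enorm (xs - y), k * penalty g h x <= enorm (xs - y) ^+ 2
    & forall j, j \notin T ->
      y ord0 j - x ord0 j =
      \sum_(i < m) k * Num.max (g x ord0 i) 0 * grad g x i ord0 j
      + \sum_(i < p) k * h x ord0 i * grad h x i ord0 j].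
Proof.
move=> xsT yT P0 k0.
pose r := enorm (xs - y) + 1.
pose C : set 'rV[R]_n := coord_subspace T `&` [set x | `|x - y| <= r].
pose phi (x : 'rV[R]_n) := \sum_(j < n) (x ord0 j - y ord0 j) ^+ 2 + k * penalty g h x.
have Cxs : C xs.
  by split=> //=; rewrite (le_trans (norm_le_enorm _))// lerDl.
have cC : compact C.
  apply: bounded_closed_compact.
    exists (r + `|y|); split; first exact: num_real.
    move=> M hM x [_ /= hx]; apply: ltW; apply: le_lt_trans hM.
    by rewrite -[x in `|x|](subrK y) (le_trans (ler_normD _ _))// lerD2r.
  apply: closedI; first exact: coord_subspace_closed.
  have -> : [set x | `|x - y| <= r] = (fun x => `|x - y|) @^-1` [set z | z <= r] by [].
  apply: closed_comp; last exact: closed_le.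
  move=> x _; exact: (cvg_norm (cvgB (@cvg_id _ (nbhs x)) (cvg_cst y))).
have cphi : continuous phi.
  have ck : continuous (fun z => k * penalty g h z).
    by move=> x; exact: cvgM (cvg_cst k) (@penalty_continuous x).
  by move=> x; exact: cvgD (@sqdist_continuous y x) (ck x).
have [x /set_mem[xT xr] hmin] := EVT_min_rV (ex_intro _ xs Cxs) cC (continuous_subspaceT cphi).
have {}hmin z : C z -> phi x <= phi z by move=> Cz; apply: hmin; exact/mem_set.
have hle : enorm (x - y) ^+ 2 + k * penalty g h x <= enorm (xs - y) ^+ 2.
  by have := hmin xs Cxs; rewrite /phi P0 mulr0 addr0 -!enormB_sqr.
have hP : 0 <= k * penalty g h x by rewrite mulr_ge0// penalty_ge0.
have hxy : enorm (x - y) <= enorm (xs - y).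
  rewrite -(@ler_pXn2r _ 2)// ?nnegrE ?enorm_ge0//.
  by apply: le_trans hle; rewrite lerDl.
exists x; split=> //.
  by apply: le_trans hle; rewrite lerDr sqr_ge0.
move=> j jT.
pose d : 'rV[R]_n := delta_mx ord0 j.
pose a i (t : R) := g (x + t *: d) ord0 i.
pose b i (t : R) := h (x + t *: d) ord0 i.
pose q C0 (u : R -> R) (t : R) := C0 * (u t - u 0) + (u t - u 0) ^+ 2.
(* [psi] dominates the increase of [phi] along the [j]-th axis and vanishes at
   zero, so zero minimises it too. *)
pose psi (t : R) := q (2 * (x ord0 j - y ord0 j)) id t +
  k * (\sum_(i < m) q (2 * Num.max (g x ord0 i) 0) (a i) t
       + \sum_(i < p) q (2 * h x ord0 i) (b i) t).
have dot_d v : dotv v d = v ord0 j.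
  rewrite /dotv (bigD1 j)//= big1 ?addr0 ?mxE ?eqxx ?mulr1// => i ij.
  by rewrite mxE eqxx (negbTE ij) mulr0.
have hder (t : R) : is_derive t (1 : R) psi
   ((2 * (x ord0 j - y ord0 j) + 2 * (t - 0)) * 1 +
    k * (\sum_(i < m) (2 * Num.max (g x ord0 i) 0 + 2 * (a i t - a i 0)) *
           grad g (x + t *: d) i ord0 j
       + \sum_(i < p) (2 * h x ord0 i + 2 * (b i t - b i 0)) *
           grad h (x + t *: d) i ord0 j)).
  have ha i : is_derive t (1 : R) (a i) (grad g (x + t *: d) i ord0 j).
    by rewrite -dot_d; exact: C1_is_derive_line.
  have hb i : is_derive t (1 : R) (b i) (grad h (x + t *: d) i ord0 j).
    by rewrite -dot_d; exact: C1_is_derive_line.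
  have hq := is_derive_quadratic (2 * (x ord0 j - y ord0 j)) 0 (is_derive_id t (1 : R)).
  have hSa := is_derive_fsum (fun i => is_derive_quadratic
    (2 * Num.max (g x ord0 i) 0) (a i 0) (ha i)).
  have hSb := is_derive_fsum (fun i => is_derive_quadratic
    (2 * h x ord0 i) (b i 0) (hb i)).
  exact: (is_deriveD hq (is_deriveZ k (is_deriveD hSa hSb))).
have a0 i : a i 0 = g x ord0 i by rewrite /a scale0r addr0.
have b0 i : b i 0 = h x ord0 i by rewrite /b scale0r addr0.
have psi0 : psi 0 = 0.
  rewrite /psi /q subrr mulr0 expr0n addr0 add0r !big1 ?addr0 ?mulr0// => i _;
  by rewrite subrr mulr0 expr0n addr0.
have hpsi (t : R) : `|t| < 1 -> 0 <= psi t.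
  move=> t1.
  have dx l : (x + t *: d) ord0 l = if l == j then x ord0 j + t else x ord0 l.
    rewrite !mxE eqxx /=; case: eqVneq => [->|_]; first by rewrite mulr1.
    by rewrite mulr0 addr0.
  have d1 : enorm d = 1.
    by apply/eqP; rewrite -(@eqrXn2 _ 2) ?enorm_ge0// sqr_enorm dot_d mxE !eqxx expr1n.
  have Cz : C (x + t *: d).
    split.
      move=> l lT; rewrite dx; case: eqP => [lj|_]; last exact: xT.
      by rewrite lj (negbTE jT) in lT.
    rewrite /= addrAC (le_trans (ler_normD _ _))// lerD//.
      exact: le_trans (norm_le_enorm _) hxy.
    rewrite normrZ; apply: le_trans (ltW t1); rewrite ler_piMr//.
    by rewrite -d1 norm_le_enorm.
  have := hmin _ Cz; rewrite -subr_ge0 => /le_trans; apply.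
  rewrite /phi /psi opprD addrACA lerD//.
    rewrite (bigD1 j)//= [X in _ - X](bigD1 j)//= dx eqxx /q.
    under eq_bigr => l lj do rewrite dx (negbTE lj).
    rewrite le_eqVlt; apply/orP; left; apply/eqP; rewrite subr0.
    ring.
  rewrite -mulrBr ler_wpM2l// /penalty opprD addrACA lerD//.
    rewrite -sumrB; apply: ler_sum => i _; rewrite lerBlDl /q a0.
    exact: sqr_max_le.
  rewrite -sumrB; apply: ler_sum => i _; rewrite /q b0 /b.
  rewrite le_eqVlt; apply/orP; left; apply/eqP; ring.
have h01 : (0 : R) \in `](-1), 1[%R by rewrite in_itv /= ltrN10 ltr01.
have dmin : is_derive (0 : R) (1 : R) psi 0.
  apply: (@derive1_at_min R psi (-1) 1 0 _ _ h01).
  - exact: le_trans (lerN10 R) ler01.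
  - by move=> t _; exact: ex_derive.
  - by move=> t; rewrite in_itv /= psi0 -ltr_norml; exact: hpsi.
have [_ +] := hder 0; have [_ ->] := dmin.
rewrite subrr mulr0 addr0 mulr1 scale0r addr0.
have -> : \sum_(i < m) (2 * Num.max (g x ord0 i) 0 + 2 * (a i 0 - a i 0)) *
   grad g x i ord0 j = 2 * \sum_(i < m) Num.max (g x ord0 i) 0 * grad g x i ord0 j.
  by rewrite mulr_sumr; apply: eq_bigr => i _; rewrite subrr mulr0 addr0 mulrA.
have -> : \sum_(i < p) (2 * h x ord0 i + 2 * (b i 0 - b i 0)) *
   grad h x i ord0 j = 2 * \sum_(i < p) h x ord0 i * grad h x i ord0 j.
  by rewrite mulr_sumr; apply: eq_bigr => i _; rewrite subrr mulr0 addr0 mulrA.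
move=> E.
under eq_bigr do rewrite -mulrA.
under [X in _ = _ + X]eq_bigr do rewrite -mulrA.
rewrite -!mulr_sumr; move: E.
move: (\sum_(i < m) _) (\sum_(i < p) _) => A B.
by lra.
Qed.

End Penalty.

(** * The estimate at a stationary point *)

Section ErrorBound.
Context {R : realType} {n m p s : nat}.
Context {g : 'rV[R]_n -> 'rV[R]_m} {h : 'rV[R]_n -> 'rV[R]_p}.
Hypotheses (hg : C1 g) (hh : C1 h).
Implicit Types (I : {set 'I_m}) (J : {set 'I_p}) (K T : {set 'I_n}).
Implicit Types (x y xs : 'rV[R]_n).

Lemma indep_grad_csel J x : free (grad_family h J x) ->
  indep (cvec g h x) (csel finset.set0 J finset.set0).
Proof.
move=> /free_image_indep hJ c; rewrite sum_csel big_set0 add0r big_set0 addr0 /=.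
move=> /(hJ (fun j => c (inl (inr j)))) hc [[i|j]|k]; rewrite !inE //.
exact: hc.
Qed.

(** In a stationarity relation holding in the coordinates outside [T], unit
    vectors indexed by [T] absorb the rest; the resulting representation of [w]
    is then reduced to an independent family that contains all of [J]. *)
Lemma sparse_multipliers J T x (lg : 'I_m -> R) (lh : 'I_p -> R)
    (w : 'rV[R]_n) :
  free (grad_family h J x) ->
  <<grad_family h J x>>%VS = <<grad_family h [set: 'I_p]%SET x>>%VS ->
  (forall i, 0 <= lg i) ->
  (forall k, k \notin T -> w ord0 k = \sum_(i < m) lg i * grad g x i ord0 k
      + \sum_(j < p) lh j * grad h x j ord0 k) ->
  exists I K (c : 'I_m + 'I_p + 'I_n -> R),
    [/\ (forall i, i \in I -> 0 < lg i), K \subset T,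
        indep (cvec g h x) (csel I J K),
        (forall i, 0 <= c (inl (inl i)))
      & w = \sum_(t in csel I J K) c t *: cvec g h x t].
Proof.
move=> fJ sJ lg0 hw.
have [mu hmu] : exists mu : 'I_p -> R,
    \sum_(j < p) lh j *: grad h x j = \sum_(j in J) mu j *: grad h x j.
  have : \sum_(j < p) lh j *: grad h x j \in <<grad_family h J x>>%VS.
    rewrite sJ; apply: memv_suml => j _; apply/memvZ/memv_span/map_f.
    by rewrite mem_enum inE.
  by move=> /mem_span_map-/(_ (enum_uniq _))[mu ->]; exists mu; rewrite big_enum.
pose eta := w - \sum_(i < m) lg i *: grad g x i - \sum_(j < p) lh j *: grad h x j.
have etaT k : k \notin T -> eta ord0 k = 0.
  move=> kT; rewrite !mxE hw// !summxE.
  under [X in _ - X - _]eq_bigr do rewrite mxE.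
  under [X in _ - _ - X]eq_bigr do rewrite mxE.
  by rewrite addrAC addrK subrr.
pose c (t : 'I_m + 'I_p + 'I_n) := match t with
  | inl (inl i) => lg i
  | inl (inr j) => if j \in J then mu j else 0
  | inr k => eta ord0 k end.
have cw : \sum_t c t *: cvec g h x t = w.
  rewrite big_sumType big_sumType /= -(row_sum_delta eta).
  rewrite (_ : \sum_(j < p) _ = \sum_(j < p) lh j *: grad h x j); last first.
    rewrite hmu [RHS]big_mkcond; apply: eq_bigr => j _.
    by case: ifP; rewrite ?scale0r.
  by rewrite /eta -(addrA w) -opprD addrC subrK.
have [c' [e1 e2 e3]] := sign_preserving_caratheodory c (indep_grad_csel fJ).
pose I := [set i | c' (inl (inl i)) != 0]%SET.
pose K := [set k | c' (inr k) != 0]%SET.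
have e3' t : t \notin csel finset.set0 J finset.set0 -> c' t != 0 -> c t != 0.
  by move=> /e3[_ h0]; apply: contra => /eqP/h0 ->.
exists I, K, c'; split.
- move=> i; rewrite inE => ci; rewrite lt_neqAle lg0 andbT eq_sym.
  by apply: (e3' (inl (inl i))) ci; rewrite !inE.
- apply/fintype.subsetP => k; rewrite inE => ck; apply/negPn/negP => kT.
  have : c (inr k) != 0 by apply: e3' ck; rewrite !inE.
  by rewrite /= etaT// eqxx.
- apply: indepS e2; apply/fintype.subsetP => -[[i|j]|k]; rewrite !inE //.
  by move=> ->.
- by move=> i; apply: (e3 (inl (inl i)) _).1; rewrite ?inE// lg0.
- rewrite -cw -e1 [RHS]big_mkcond; apply: eq_bigr => t _.
  case: ifPn => // tn; apply/eqP; rewrite scaler_eq0; apply/orP; left.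
  apply/negPn/negP => ct; move/negP: tn; apply.
  case: t ct => [[i|j]|k] ct; rewrite !inE //.
  apply/negPn/negP => jJ.
  have : c (inl (inr j)) != 0 by apply: e3' ct; rewrite !inE.
  by rewrite /= (negbTE jJ) eqxx.
Qed.

Lemma violation_ge0 x : 0 <= violation g h x.
Proof.
by apply: addr_ge0; apply: sumr_ge0 => i _ //; rewrite le_max lexx orbT.
Qed.

Lemma max_le_violation x i : Num.max (g x ord0 i) 0 <= violation g h x.
Proof.
rewrite /violation (bigD1 i)//= -addrA lerDl addr_ge0//; first last.
  by apply: sumr_ge0.
by apply: sumr_ge0 => k _; rewrite le_max lexx orbT.
Qed.

Lemma abs_le_violation x j : `|h x ord0 j| <= violation g h x.
Proof.
rewrite /violation (bigD1 j)//= addrCA lerDl addr_ge0//; last first.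
  by apply: sumr_ge0.
by apply: sumr_ge0 => k _; rewrite le_max lexx orbT.
Qed.

(** Pair [y - x] with its own representation.  A constraint gradient contributes
    at most the violation at [y] plus the first-order error, since
    [g x ord0 i > 0] on the active part; unit vectors contribute nothing because
    [x] and [y] both vanish on [T].  The choice of [1 / (2 M)] as relative error
    lets half of [enorm (y - x)] be absorbed. *)
Lemma stationary_estimate xs T x y (M k : R) J :
  0 < M -> 0 <= k ->
  coord_subspace T x -> coord_subspace T y ->
  T \subset I0 xs -> (#|T| <= n - s)%N ->
  cpld_at s g h xs J -> free (grad_family h J x) ->
  <<grad_family h J x>>%VS = <<grad_family h [set: 'I_p]%SET x>>%VS ->
  multiplier_bound s g h xs M x ->
  (forall i, 0 < g x ord0 i -> i \in active g xs) ->
  (forall i, `|g y ord0 i - g x ord0 i - dotv (grad g x i) (y - x)|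
       <= (2 * M)^-1 * enorm (y - x)) ->
  (forall j, `|h y ord0 j - h x ord0 j - dotv (grad h x j) (y - x)|
       <= (2 * M)^-1 * enorm (y - x)) ->
  (forall j, j \notin T -> y ord0 j - x ord0 j =
      \sum_(i < m) k * Num.max (g x ord0 i) 0 * grad g x i ord0 j
      + \sum_(i < p) k * h x ord0 i * grad h x i ord0 j) ->
  enorm (y - x) <= 2 * M * (violation g h y + \sum_(j < p) `|h x ord0 j|).
Proof.
move=> M0 k0 xT yT hT cT hJ fJ sJ hM hact hgo hho hst.
set e := enorm (y - x) in hgo hho *.
have e_ge0 : 0 <= e := enorm_ge0 _.
set H := \sum_(j < p) `|h x ord0 j|.
have H0 : 0 <= H by apply: sumr_ge0.
have V0 := violation_ge0 y.
have lg0 i : 0 <= k * Num.max (g x ord0 i) 0 by rewrite mulr_ge0// le_max lexx orbT.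
have [|I [K [c [hI hK hi c0 hw]]]] := @sparse_multipliers J T x
  (fun i => k * Num.max (g x ord0 i) 0) (fun j => k * h x ord0 j) (y - x) fJ sJ lg0.
  by move=> j jT; rewrite !mxE hst.
have gI i : i \in I -> 0 < g x ord0 i.
  move=> /hI; rewrite !ltNge; apply: contra => gx.
  by rewrite max_r// mulr0.
have Ia : I \subset active g xs by apply/fintype.subsetP => i /gI /hact.
have := hM I J K hJ Ia (fintype.subset_trans hK hT)
  (leq_trans (subset_leq_card hK) cT) hi c (fun i _ => c0 i).
rewrite -hw => hc.
pose D := violation g h y + H + (2 * M)^-1 * e.
have eps0 : 0 < (2 * M)^-1 by rewrite invr_gt0 mulr_gt0.
have ee0 : 0 <= (2 * M)^-1 * e by rewrite mulr_ge0// ltW.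
have D0 : 0 <= D by rewrite /D addr_ge0// addr_ge0.
have hD t : t \in csel I J K -> c t * dotv (cvec g h x t) (y - x) <= `|c t| * D.
  case: t => [[i|j]|l]; rewrite inE /= => ht.
  - rewrite ger0_norm// ler_wpM2l//.
    have := hgo i; rewrite ler_norml => /andP[h1 h2].
    have := gI i ht; have := max_le_violation y i.
    rewrite ge_max => /andP[h3 _] h4.
    rewrite /D; lra.
  - apply: le_trans (ler_norm _) _; rewrite normrM ler_wpM2l//.
    have := hho j; have := abs_le_violation y j.
    have : `|h x ord0 j| <= H by rewrite /H (bigD1 j)//= lerDl; apply: sumr_ge0.
    rewrite /D !ler_norml => /andP[h1 h2] /andP[h3 h4] /andP[h5 h6].
    by apply/andP; split; lra.
  - have lT := fintype.subsetP hK l ht.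
    rewrite (_ : dotv _ _ = 0) ?mulr0 ?mulr_ge0//.
    rewrite /dotv big1// => a _; rewrite !mxE eqxx /=; case: eqP => [->|_].
      by rewrite xT// yT// subrr mulr0.
    by rewrite mul0r.
have e2 : e ^+ 2 <= M * e * D.
  have -> : e ^+ 2 = \sum_(t in csel I J K) c t * dotv (cvec g h x t) (y - x).
    by rewrite /e sqr_enorm {1}hw dotv_suml.
  apply: (@le_trans _ _ (\sum_(t in csel I J K) `|c t| * D)); first exact: ler_sum.
  rewrite -mulr_suml ler_wpM2r//; apply: le_trans hc _.
  by rewrite ler_wpM2l ?norm_le_enorm// ltW.
have [->|en0] := eqVneq e 0; first by apply: mulr_ge0; [rewrite mulr_ge0// ltW|exact: addr_ge0].
have e_gt0 : 0 < e by rewrite lt_neqAle eq_sym en0.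
have e3 : e <= M * D.
  by rewrite -(ler_pM2l e_gt0) -expr2 (le_trans e2)// mulrA (mulrC M).
have : M * ((2 * M)^-1 * e) = e / 2 by field; rewrite gt_eqF.
move: e3; rewrite /D !mulrDr -!mulrA => e3 e4.
lra.
Qed.

End ErrorBound.

(** * Local error bound and exact penalty *)

Lemma exists_subset_card (T : finType) (A : {set T}) (k : nat) :
  (k <= #|A|)%N -> exists2 B : {set T}, B \subset A & #|B| = k.
Proof.
move=> kA; exists [set x in take k (enum A)]%SET.
  by apply/fintype.subsetP => x; rewrite inE => /mem_take; rewrite mem_enum.
by rewrite cardsE (card_uniqP _) ?take_uniq ?enum_uniq// size_takel// -cardE.
Qed.

Section Limit.
Context {R : realType} {n m p : nat}.
Context {g : 'rV[R]_n -> 'rV[R]_m} {h : 'rV[R]_n -> 'rV[R]_p}.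
Hypotheses (hg : C1 g) (hh : C1 h).

Lemma penalty_eq0 x : penalty g h x = 0 ->
  (forall i, g x ord0 i <= 0) /\ (forall j, h x ord0 j = 0).
Proof.
have s0 : 0 <= \sum_(i < m) Num.max (g x ord0 i) 0 ^+ 2.
  by apply: sumr_ge0 => i _; exact: sqr_ge0.
have t0 : 0 <= \sum_(j < p) h x ord0 j ^+ 2.
  by apply: sumr_ge0 => i _; exact: sqr_ge0.
move=> /eqP; rewrite /penalty paddr_eq0// => /andP[/eqP hs /eqP ht]; split=> [i|j].
  have /eqP := psumr_eq0P (fun i _ => sqr_ge0 (Num.max (g x ord0 i) 0)) hs (erefl : xpredT i).
  by rewrite sqrf_eq0 => /eqP <-; rewrite le_max lexx.
have /eqP := psumr_eq0P (fun j _ => sqr_ge0 (h x ord0 j)) ht (erefl : xpredT j).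
by rewrite sqrf_eq0 => /eqP.
Qed.

Lemma enorm_continuous : continuous (@enorm R n).
Proof.
move=> x; apply: continuous_comp; last exact: sqrt_continuous.
apply: continuous_fsum => j; apply: continuous_fsqr; exact: coord_continuous.
Qed.

Lemma penalty_limit (T : {set 'I_n}) (y : 'rV[R]_n) (B B' c V : R)
    (x : nat -> 'rV[R]_n) :
  (forall k, coord_subspace T (x k)) ->
  (forall k, k.+1%:R * penalty g h (x k) <= B) ->
  (forall k, enorm (x k - y) <= B') ->
  (forall k, enorm (y - x k) <= c * (V + \sum_(j < p) `|h (x k) ord0 j|)) ->
  exists z, [/\ coord_subspace T z, penalty g h z = 0 & enorm (y - z) <= c * V].
Proof.
move=> xT xP xB xe.
have hb k (j : 'I_n) : `|x k ord0 j| <= B' + `|y|.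
  rewrite -[x k](subrK y) mxE (le_trans (ler_normD _ _))// lerD ?coord_le_norm//.
  exact: le_trans (coord_le_enorm _ _) (xB k).
have [phi hphi [l hl]] := bolzano_weierstrass_fin hb.
pose z : 'rV[R]_n := \row_j l j.
have xz : x (phi k) @[k --> \oo] --> z.
  by apply/cvg_rowP => j; rewrite mxE; exact: hl.
have phi_oo := increasing_seq_cvg hphi.
have zP : penalty g h z = 0.
  have cP : penalty g h (x (phi k)) @[k --> \oo] --> penalty g h z.
    exact: (cvg_comp (fun k => x (phi k)) (penalty g h) xz
      (@penalty_continuous _ _ _ _ _ _ hg hh z)).
  apply/eqP; rewrite eq_le penalty_ge0 andbT.
  have c0 : B / (phi k).+1%:R @[k --> \oo] --> (0 : R).
    rewrite -(mulr0 B); apply: cvgM; first exact: cvg_cst.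
    exact: (cvg_comp phi (fun k => k.+1%:R^-1) phi_oo (@cvg_harmonic R)).
  apply: (ler_cvg_to cP c0); near=> k.
  by rewrite ler_pdivlMr// mulrC xP.
have [_ hz] := penalty_eq0 zP.
exists z; split=> //.
  move=> j jT; rewrite mxE.
  apply: (cvg_unique (@Rhausdorff R) (hl j)).
  rewrite (_ : (fun k => x (phi k) ord0 j) = fun=> 0); first exact: cvg_cst.
  by apply/funext => k; exact: xT.
have ch : \sum_(j < p) `|h (x (phi k)) ord0 j| @[k --> \oo] --> (0 : R).
  have z0 : \sum_(j < p) `|h z ord0 j| = 0.
    by rewrite big1// => j _; rewrite hz normr0.
  rewrite -[X in _ --> X]z0.
  apply: cvg_sum => j _.
  exact: cvg_norm (cvg_comp (fun k => x (phi k)) (fun w => h w ord0 j) xz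
    (@C1_coord_continuous _ _ _ _ hh j z)).
have ce : enorm (y - x (phi k)) @[k --> \oo] --> enorm (y - z).
  exact: (cvg_comp (fun k => y - x (phi k)) (@enorm R n) (cvgB (cvg_cst y) xz)
    (@enorm_continuous (y - z))).
have cr : c * (V + \sum_(j < p) `|h (x (phi k)) ord0 j|) @[k --> \oo] --> c * (V + 0).
  exact: cvgM (cvg_cst c) (cvgD (cvg_cst V) ch).
rewrite -[V]addr0; apply: (ler_cvg_to ce cr).
by near=> k; exact: xe.
Unshelve. all: by end_near. Qed.

End Limit.

Section LocalErrorBound.
Context {R : realType} {n m p s : nat}.
Context {g : 'rV[R]_n -> 'rV[R]_m} {h : 'rV[R]_n -> 'rV[R]_p}.
Hypotheses (hg : C1 g) (hh : C1 h) (hsn : (s < n)%N).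

Lemma C1_first_order_all (q : nat) (G : 'rV[R]_n -> 'rV[R]_q) (hG : C1 G)
    (x0 : 'rV[R]_n) (e : R) : 0 < e ->
  \forall r \near 0^'+, forall i x y, `|x - x0| < r -> `|y - x0| < r ->
    `|G y ord0 i - G x ord0 i - dotv (grad G x i) (y - x)|
       <= e * enorm (y - x).
Proof.
move=> e0; apply: filter_forall => i.
have [r r0 hr] := C1_first_order hG i x0 e0.
near=> t => x y xt yt; have tr : t <= r by near: t; exact: nbhs_right_le.
by apply: hr; [exact: lt_le_trans xt tr|exact: lt_le_trans yt tr].
Unshelve. all: by end_near. Qed.

Lemma near_active xs : (forall i, g xs ord0 i <= 0) ->
  \forall x \near xs, forall i, 0 < g x ord0 i -> i \in active g xs.
Proof.
move=> gxs; apply: (@filter_forall _ _ _ _ (nbhs_filter xs)) => i.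
have [iA|iA] := boolP (i \in active g xs); first by apply: nearW.
have gi : g xs ord0 i < 0 by rewrite lt_neqAle gxs andbT; rewrite inE in iA.
have hlt : \forall x \near xs, g x ord0 i < 0.
  exact: (cvgr_lt (g xs ord0 i) (@C1_coord_continuous _ _ _ _ hg i xs) 0 gi).
by apply: filterS hlt => x hx /(lt_trans hx); rewrite ltxx.
Qed.

Lemma near_support (xs : 'rV[R]_n) :
  \forall x \near xs, I0 x \subset I0 xs.
Proof.
have h1 j : \forall x \near xs, j \in I0 x -> j \in I0 xs.
  have [xj|xj] := eqVneq (xs ord0 j) 0.
    by apply: (@filterE _ _ (nbhs_filter xs)) => x; rewrite !inE xj eqxx.
  have hne : \forall x \near xs, (x : 'rV[R]_n) ord0 j != 0.
    exact: (@cvgr_neq0 _ _ _ _ (nbhs_filter xs) _ _ (@coord_continuous R 1 n ord0 j xs) xj).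
  by apply: (@filterS _ _ (nbhs_filter xs) _ _ _ hne) => x /negbTE xj0; rewrite !inE xj0.
have := @filter_forall _ _ _ _ (nbhs_filter xs) h1.
by apply: filterS => x hx; apply/fintype.subsetP.
Qed.

Lemma local_error_bound xs : feasible s g h xs ->
  (\forall x \near xs, cpld_basis_at s g h xs x) ->
  exists alpha rho : R, [/\ 0 <= alpha, 0 < rho &
    forall y, eball xs rho y -> sparse s y ->
      exists2 z, feasible s g h z & enorm (y - z) <= alpha * violation g h y].
Proof.
move=> [gxs hxs sxs] hJ.
have [M M0 hM] := @uniform_bounded_multipliers _ _ _ _ s _ _ hg hh xs.
have eps0 : 0 < (2 * M)^-1 by rewrite invr_gt0 mulr_gt0.
have hA := near_active gxs.
have [r0 r00 hr0] : exists2 r0 : R, 0 < r0 & forall x, `|x - xs| < r0 ->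
   [/\ cpld_basis_at s g h xs x, multiplier_bound s g h xs M x,
    forall i, 0 < g x ord0 i -> i \in active g xs & I0 x \subset I0 xs].
  have hall : \forall x \near xs, [/\ cpld_basis_at s g h xs x,
      multiplier_bound s g h xs M x,
      forall i, 0 < g x ord0 i -> i \in active g xs & I0 x \subset I0 xs].
    have hS := near_support xs.
    near=> x; split; near: x; [exact: hJ|exact: hM|exact: hA|exact: hS].
  have [r0 /= r00 hr0] := (nbhs_ballP _ _).1 hall; exists r0 => // x xr.
  by apply: hr0; rewrite -ball_normE /= distrC.
have [r [r_gt0 rr0 hgo hho]] : exists r : R, [/\ 0 < r, r <= r0,
    forall i x y, `|x - xs| < r -> `|y - xs| < r ->
    `|g y ord0 i - g x ord0 i - dotv (grad g x i) (y - x)|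
       <= (2 * M)^-1 * enorm (y - x) &
    forall i x y, `|x - xs| < r -> `|y - xs| < r ->
    `|h y ord0 i - h x ord0 i - dotv (grad h x i) (y - x)|
       <= (2 * M)^-1 * enorm (y - x)].
  have H1 := C1_first_order_all hg xs eps0; have H2 := C1_first_order_all hh xs eps0.
  have : \forall r \near (0 : R)^'+, [/\ 0 < r, r <= r0,
    forall i x y, `|x - xs| < r -> `|y - xs| < r ->
    `|g y ord0 i - g x ord0 i - dotv (grad g x i) (y - x)|
       <= (2 * M)^-1 * enorm (y - x) &
    forall i x y, `|x - xs| < r -> `|y - xs| < r ->
    `|h y ord0 i - h x ord0 i - dotv (grad h x i) (y - x)|
       <= (2 * M)^-1 * enorm (y - x)].
    near=> r; split; near: r; [exact: nbhs_right_gt|exact: nbhs_right_le|exact: H1|exact: H2].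
  by move=> /filter_ex.
exists (2 * M), (r / 2); split; [by rewrite mulr_ge0// ltW|by rewrite divr_gt0|].
move=> y yr sy.
have yr2 : enorm (y - xs) < r / 2 by [].
have yr1 : `|y - xs| < r by have := norm_le_enorm (y - xs); lra.
have [_ _ _ Iy] := hr0 y (lt_le_trans yr1 rr0).
have cI0 : (n - s <= #|I0 y|)%N.
  have -> : I0 y = (~: Ipm y)%SET by apply/setP => j; rewrite !inE negbK.
  by rewrite cardsCs finset.setCK card_ord leq_sub2l.
have [T TI cT] := exists_subset_card cI0.
have TI' := fintype.subset_trans TI Iy.
have yT : coord_subspace T y by move=> j /(fintype.subsetP TI); rewrite inE => /eqP.
have xsT : coord_subspace T xs by move=> j /(fintype.subsetP TI'); rewrite inE => /eqP.
have P0 : penalty g h xs = 0.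
  rewrite /penalty !big1 ?addr0// => i _; first by rewrite hxs expr0n.
  by rewrite max_r// expr0n.
have /choice[x hx] : forall k : nat, exists x, [/\ coord_subspace T x,
    enorm (x - y) <= enorm (xs - y),
    k.+1%:R * penalty g h x <= enorm (xs - y) ^+ 2
    & enorm (y - x) <= 2 * M * (violation g h y + \sum_(j < p) `|h x ord0 j|)].
  move=> k; have [x [xT xy xP xst]] := penalty_minimizer hg hh xsT yT P0 (ler0n R k.+1).
  have xr : `|x - xs| < r.
    rewrite -(subrKA y) (le_lt_trans (ler_normD _ _))//.
    have h1 := norm_le_enorm (x - y); have h2 := norm_le_enorm (y - xs).
    rewrite (enormB xs) in xy.
    by lra.
  have [[J [cJ fJ sJ]] hMx hax _] := hr0 x (lt_le_trans xr rr0).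
  exists x; split=> //.
  apply: (stationary_estimate M0 (ler0n R k.+1) xT yT TI' _ cJ fJ sJ hMx hax _ _ xst).
  - by rewrite cT.
  - by move=> i; exact: hgo.
  - by move=> i; exact: hho.
have [z [zT zP ze]] := @penalty_limit _ _ _ _ _ _ hg hh T y _ _ _ _ x
  (fun k => let: And4 a _ _ _ := hx k in a)
  (fun k => let: And4 _ _ a _ := hx k in a)
  (fun k => let: And4 _ a _ _ := hx k in a)
  (fun k => let: And4 _ _ _ a := hx k in a).
exists z => //; have [gz hz] := penalty_eq0 zP; split=> //.
rewrite /sparse /= /norm0.
apply: (@leq_trans #|~: T|%SET).
  apply: subset_leq_card; apply/fintype.subsetP => j; rewrite !inE.
  by apply: contra => jT; rewrite zT.
by rewrite cardsCs finset.setCK card_ord cT subKn// ltnW.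
Unshelve. all: by end_near. Qed.

Lemma violation_feasible xs : feasible s g h xs -> violation g h xs = 0.
Proof.
move=> [gx hx _]; rewrite /violation !big1 ?addr0// => i _.
  by rewrite hx normr0.
by rewrite max_r.
Qed.

(** Near [xs] the feasible point [z] supplied by the error bound is so close to
    [x] that local optimality applies to it, and the decrease from [f z] to
    [f x] is at most [L * alpha * violation g h x]. *)
Lemma exact_penalty (f : 'rV[R]_n -> R) xs (alpha rho : R) :
  0 < rho ->
  (forall y, eball xs rho y -> sparse s y ->
     exists2 z, feasible s g h z & enorm (y - z) <= alpha * violation g h y) ->
  local_optimal f (feasible s g h) xs ->
  forall L mu : R, lipschitz_near f xs L -> L * alpha <= mu ->
    local_optimal (fun x => f x + mu * violation g h x) (@sparse R n s) xs.
Proof.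
move=> rho0 hbound [fxs [r r0 hopt]] L mu [d d0 hL] hmu.
split; first by case: fxs.
have n0 : (0 < n)%N by exact: leq_ltn_trans hsn.
have L0 : 0 <= L.
  pose w : 'rV[R]_n := delta_mx ord0 (Ordinal n0).
  have w0 : w != 0.
    by apply/eqP => /rowP/(_ (Ordinal n0))/eqP; rewrite !mxE !eqxx oner_eq0.
  pose t := d / n.+1%:R / (2 * `|w|).
  have w1 : 0 < `|w| by rewrite normr_gt0.
  have t0 : 0 < t by rewrite divr_gt0// ?mulr_gt0// divr_gt0.
  have tw : `|t *: w| < d / n.+1%:R.
    rewrite normrZ gtr0_norm// /t invfM mulrA divfK ?gt_eqF//.
    by rewrite ltr_pdivrMr// ltr_pMr ?divr_gt0// ltr1n.
  have := hL (xs + t *: w) xs.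
  rewrite [xs + _]addrC addrK => /(_ _ _)/(le_trans (normr_ge0 _)).
  rewrite pmulr_lge0; last first.
    apply: lt_le_trans (norm_le_enorm _).
    by rewrite normr_gt0 scaler_eq0 negb_or gt_eqF.
  by apply; apply: norm_lt_eball => //; rewrite ?addrK// subrr normr0 divr_gt0.
pose r1 := Num.min r d.
have r10 : 0 < r1 by rewrite lt_min r0.
have cv : continuous (fun x => `|alpha| * violation g h x + `|x - xs|).
  have c1 : continuous (fun x => \sum_(i < m) Num.max (g x ord0 i) 0).
    apply: continuous_fsum => i x.
    apply: continuous_max; [exact: C1_coord_continuous|exact: cst_continuous].
  have c2 : continuous (fun x => \sum_(j < p) `|h x ord0 j|).
    apply: continuous_fsum => j x.
    exact: cvg_norm (@C1_coord_continuous _ _ _ _ hh j x).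
  move=> x; exact: cvgD (cvgM (cvg_cst `|alpha|) (cvgD (c1 x) (c2 x)))
    (cvg_norm (cvgB (@cvg_id _ (nbhs x)) (cvg_cst xs))).
have hnear : \forall x \near xs, `|alpha| * violation g h x + `|x - xs| < r1 / n.+1%:R.
  apply: (cvgr_lt _ (cv xs)).
  by rewrite (violation_feasible fxs) mulr0 subrr normr0 addr0 divr_gt0.
have [r2 /= r20 hr2] := (nbhs_ballP _ _).1 hnear.
exists (Num.min rho r2); first by rewrite lt_min rho0.
move=> x sx; rewrite /eball /= lt_min => /andP[xrho xr2].
rewrite (violation_feasible fxs) mulr0 addr0.
have [z fz ez] := hbound x xrho sx.
have V0 := violation_ge0 (g := g) (h := h) x.
have hlt : `|alpha| * violation g h x + `|x - xs| < r1 / n.+1%:R.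
  by apply: hr2; rewrite -ball_normE /= distrC; exact: le_lt_trans (norm_le_enorm _) xr2.
have ez' : `|z - x| <= `|alpha| * violation g h x.
  rewrite distrC; apply: le_trans (norm_le_enorm _) _; apply: le_trans ez _.
  by apply: ler_wpM2r => //; exact: ler_norm.
have zb : eball xs r1 z.
  apply: norm_lt_eball => //; apply: le_lt_trans hlt.
  by rewrite -(subrKA x) (le_trans (ler_normD _ _))// lerD2r.
have xb : eball xs r1 x.
  apply: norm_lt_eball => //; apply: le_lt_trans hlt.
  by rewrite lerDr mulr_ge0.
have fz1 : f xs <= f z by apply: hopt => //; rewrite /eball /= (lt_le_trans zb)// ge_min lexx.
have r1d : r1 <= d by rewrite ge_min lexx orbT.
have := hL x z (lt_le_trans xb r1d) (lt_le_trans zb r1d).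
rewrite ler_norml => /andP[hfz _].
have h1 : L * enorm (x - z) <= L * (alpha * violation g h x) by rewrite ler_wpM2l.
have h2 : L * (alpha * violation g h x) <= mu * violation g h x by rewrite mulrA ler_wpM2r.
lra.
Qed.

End LocalErrorBound.

Theorem theorem4p2 (R : realType) (n m p s : nat) (hsn : (s < n)%N)
    (f : 'rV[R]_n -> R) (g : 'rV[R]_n -> 'rV[R]_m) (h : 'rV[R]_n -> 'rV[R]_p)
    (hf : C1 f) (hg : C1 g) (hh : C1 h)
    (xs : 'rV[R]_n) (hxs : feasible s g h xs)
    (hCQ : ccop_licq g h xs \/ ccop_nnamcq s g h xs \/ ccop_crcq s g h xs \/
           ccop_rcrcq s g h xs \/ ccop_cpld s g h xs \/
           ccop_ercpld s g h xs \/ ccop_rcpld s g h xs) :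
  exists alpha rho : R,
    [/\ 0 <= alpha, 0 < rho,
        (forall x, eball xs rho x -> sparse s x ->
           set_dist (feasible s g h) x <= alpha * violation g h x)
      & (local_optimal f (feasible s g h) xs ->
         forall Lf mu : R, lipschitz_near f xs Lf -> Lf * alpha <= mu ->
           local_optimal (fun x => f x + mu * violation g h x)
             (@sparse R n s) xs)].
Proof.
have [alpha [rho [alpha0 rho0 hbound]]] :=
  local_error_bound hg hh hsn hxs (cq_cpld_basis hh hCQ).
exists alpha, rho; split=> //; last exact: exact_penalty rho0 hbound.
move=> x xr sx; have [z fz ez] := hbound x xr sx.
apply: le_trans ez; apply: ge_inf; last by exists z.
by exists 0 => _ [y _ <-]; exact: enorm_ge0.
Qed.
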